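(* Let $K$ be a field and $n\ge1$. (1) There is a bijection between the set of torsion pairs $(\mathcal{T},\mathcal{F})$ on $\mathcal{E}_n$ such that $L_{\mathcal{T}}\neq\emptyset$ and the set of complete strong 1-type part partitions $\{\Delta,\Delta_1,\dots,\Delta_m\}$ of $\tilde{A}_n$ with $\Delta\ne\emptyset$. (2) There is a bijection between the set of torsion pairs $(\mathcal{T},\mathcal{F})$ on $\mathcal{E}_n$ such that $R_{\mathcal{F}}\ne\emptyset$ and the set of complete strong 2-type part partitions $\{\Delta,\Delta_1,\dots,\Delta_m\}$ of $\tilde{A}_n$ with $\Delta\neq\emptyset$.
   Context: $\tilde{A}_n$ is the cyclic quiver with vertex set $\{v_1,\dots,v_n\}$ and arrows $v_1\to v_2\to\dots\to v_n\to v_1$; $J$ is the ideal of $K\tilde A_n$ generated by all arrows. $\mathcal{E}_n$ is the category of finite-dimensional $K\tilde{A}_n$-modules $M$ with $J^NM=0$ for some $N$; $S_i$ is the simple module at $v_i$. For a subcategory $\mathcal{D}$ of $\mathcal{E}_n$, $L_{\mathcal{D}}$ is the set of vertices $v_i$ such that $\mathcal{D}$ contains infinitely many (pairwise non-isomorphic) indecomposable modules with top $S_i$, and $R_{\mathcal{D}}$ is the set of vertices $v_i$ such that $\mathcal{D}$ contains infinitely many indecomposable modules with socle $S_i$. A torsion pair on $\mathcal{E}_n$ is a pair $(\mathcal{T},\mathcal{F})$ of full (isomorphism-closed) subcategories with $\mathrm{Hom}(X,Y)=0$ for $X\in\mathcal{T},Y\in\mathcal{F}$ and such that every $X\in\mathcal{E}_n$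 has an exact sequence $0\to X_{\mathcal{T}}\to X\to X_{\mathcal{F}}\to0$ with $X_{\mathcal T}\in\mathcal T,X_{\mathcal F}\in\mathcal F$. For a quiver $Q$ and $\Omega\subseteq Q_0$, $Q(\Omega)$ is the full subquiver on $\Omega$. Let $\{\Delta_0,\Delta_1,\dots,\Delta_m\}$ ($m\ge0$) be a tuple of pairwise disjoint subsets of $Q_0$ with $\Delta_1,\dots,\Delta_m$ nonempty. It is a strong 1-type part partition of $Q$ if for all $i>0$ (indices at most $m$) $\Delta_{2i-1}$ contains all sinks of $Q(Q_0-\Delta_0-\dots-\Delta_{2i-2})$ and $\Delta_{2i}$ contains all sources of $Q(Q_0-\Delta_0-\dots-\Delta_{2i-1})$. It is a strong 2-type part partition if for all $i>0$ (indices at most $m$) $\Delta_{2i-1}$ contains all sources of $Q(Q_0-\Delta_0-\dots-\Delta_{2i-2})$ and $\Delta_{2i}$ contains all sinks of $Q(Q_0-\Delta_0-\dots-\Delta_{2i-1})$. It is complete if the union of all $\Delta_i$ is $Q_0$. *)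

(* Defs.v *)
From HB Require Import structures.
From mathcomp Require Import all_boot all_order all_algebra.
From mathcomp Require Import finmap monalg.

Set Implicit Arguments.
Unset Strict Implicit.
Unset Printing Implicit Defensive.

Import GRing.Theory.
Local Open Scope ring_scope.

Record quiver := Quiver {
  vertex : finType;
  arrow : finType;
  src : arrow -> vertex;
  tgt : arrow -> vertex
}.

(** The quiver Ã_n, with v_(i+1) represented by i : 'I_n; ordS is the cyclic
    successor, so that arrow i goes from i to i+1 mod n. *)
Definition cyclic_quiver (n : nat) : quiver :=
  @Quiver 'I_n 'I_n id (@ordS n).

(* Bilinear extension, for an abstract module spanned by a family [u]. *)
Section BilinearExtension.
Variables (K : fieldType) (V : lmodType K) (I : Type) (u : I -> V).
Hypothesis u_ind : forall P : V -> Prop,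
  P 0 -> (forall c i x, P x -> P (c *: u i + x)) -> forall x, P x.
Variable mul : V -> V -> V.
Hypotheses (Dl : left_distributive mul +%R) (Dr : right_distributive mul +%R).
Hypotheses (Zl : forall c x y, mul (c *: x) y = c *: mul x y)
           (Zr : forall c x y, mul x (c *: y) = c *: mul x y).

Let l0 x : mul 0 x = 0. Proof. by have := Zl 0 0 x; rewrite !scale0r. Qed.
Let r0 x : mul x 0 = 0. Proof. by have := Zr 0 x 0; rewrite !scale0r. Qed.

Lemma bilinear_assoc :
  (forall i j k, mul (u i) (mul (u j) (u k)) = mul (mul (u i) (u j)) (u k)) ->
  associative mul.
Proof.
move=> AU x y z; elim/u_ind: x => [|c p x IHx]; first by rewrite !l0.
rewrite !Dl !Zl IHx; congr (_ *: _ + _).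
elim/u_ind: y {IHx} => [|d q y IHy]; first by rewrite !(l0, r0).
rewrite Dl !Dr Dl !(Zl, Zr) IHy; congr (_ *: _ + _).
elim/u_ind: z {IHy} => [|e r z IHz]; first by rewrite !r0.
by rewrite !Dr !Zr IHz AU.
Qed.

Lemma bilinear_form (phi : V -> K) :
  linear_for *%R phi ->
  (forall i j, phi (mul (u i) (u j)) = phi (u i) * phi (u j)) ->
  forall x y, phi (mul x y) = phi x * phi y.
Proof.
move=> lphi HU x y.
have phi0 : phi 0 = 0.
  by have := lphi (-1) 0 0; rewrite scaler0 addr0 mulN1r addNr.
elim/u_ind: x => [|c p x IHx]; first by rewrite l0 phi0 mul0r.
rewrite Dl Zl !lphi IHx mulrDl -mulrA; congr (_ * _ + _).
elim/u_ind: y {IHx} => [|d q y IHy]; first by rewrite r0 phi0 mulr0.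
by rewrite Dr Zr !lphi IHy mulrDr mulrCA HU.
Qed.

End BilinearExtension.

Section PathAlgebra.
Local Open Scope fset_scope.
Local Open Scope ring_scope.
Variable Q : quiver.

Fixpoint walk (v : vertex Q) (s : seq (arrow Q)) : bool :=
  if s is a :: s' then (src a == v) && walk (tgt a) s' else true.

(** A path is a starting vertex with a (possibly empty) sequence of consecutive
    arrows, listed in the order in which they are followed. *)
Definition qpath := {p : vertex Q * seq (arrow Q) | walk p.1 p.2}.
HB.instance Definition _ := SubChoice.on qpath.

Definition pstart (p : qpath) : vertex Q := (val p).1.
Definition psteps (p : qpath) : seq (arrow Q) := (val p).2.
Definition pend (p : qpath) : vertex Q :=
  last (pstart p) [seq tgt a | a <- psteps p].

Definition trivial_path (v : vertex Q) : qpath := exist _ (v, [::]) isT.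

Lemma arrow_path_subproof (a : arrow Q) : walk (src a) [:: a].
Proof. by rewrite /= eqxx. Qed.

Definition arrow_path (a : arrow Q) : qpath :=
  exist _ (src a, [:: a]) (arrow_path_subproof a).

(** Paths compose like functions: [pcomp p q] is "first q, then p". *)
Definition pcomp (p q : qpath) : option qpath :=
  if pend q == pstart p then insub (pstart q, psteps q ++ psteps p) else None.

Lemma walk_cat v s t :
  walk v (s ++ t) = walk v s && walk (last v [seq tgt a | a <- s]) t.
Proof. by elim: s v => //= a s IHs v; rewrite IHs andbA. Qed.

Lemma pcompP p q : pend q = pstart p ->
  exists2 r, pcomp p q = Some r & val r = (pstart q, psteps q ++ psteps p).
Proof.
move=> e; rewrite /pcomp e eqxx.
have w : walk (pstart q) (psteps q ++ psteps p).
  rewrite walk_cat (valP q) /=; move: (valP p).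
  by rewrite -/(pstart p) -/(psteps p) -e.
by exists (exist _ (pstart q, psteps q ++ psteps p) w); rewrite ?insubT.
Qed.

Lemma pcomp_ends p q r : pcomp p q = Some r ->
  pstart r = pstart q /\ pend r = pend p.
Proof.
rewrite /pcomp; case: eqP => // e; case: insubP => // r' _ er [<-].
split; first by rewrite /pstart er.
by rewrite /pend /pstart /psteps er /= map_cat last_cat -/(psteps q) -/(pend q) e.
Qed.

Lemma pcompA p q r :
  obind (pcomp p) (pcomp q r) = obind (pcomp^~ r) (pcomp p q).
Proof.
have [e1|/eqP n1] := eqVneq (pend r) (pstart q); last first.
  have -> : pcomp q r = None by rewrite /pcomp; case: eqP.
  case E: (pcomp p q) => [s|] //=; have [es _] := pcomp_ends E.
  by rewrite /pcomp es; case: eqP.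
have [qr Eqr vqr] := pcompP e1; have [sqr eqr] := pcomp_ends Eqr.
have [e2|/eqP n2] := eqVneq (pend q) (pstart p); last first.
  have -> : pcomp p q = None by rewrite /pcomp; case: eqP.
  by rewrite Eqr /= /pcomp eqr; case: eqP.
have [pq Epq vpq] := pcompP e2; have [spq epq] := pcomp_ends Epq.
rewrite Eqr Epq /= /pcomp eqr e2 spq e1 !eqxx.
by rewrite /pstart /psteps vqr vpq /= catA.
Qed.

Lemma pcomp_trivl v p :
  pcomp (trivial_path v) p = if pend p == v then Some p else None.
Proof.
rewrite /pcomp /=; case: eqP => // e; rewrite cats0.
by rewrite -[in LHS]surjective_pairing valK.
Qed.

Lemma pcomp_trivr v p :
  pcomp p (trivial_path v) = if pstart p == v then Some p else None.
Proof.
rewrite /pcomp /pend /= eq_sym; case: eqP => // <-.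
by rewrite -[in LHS]surjective_pairing valK.
Qed.

Lemma pcomp_eq_triv p q v : pcomp p q = Some (trivial_path v) ->
  p = trivial_path v /\ q = trivial_path v.
Proof.
rewrite /pcomp; case: eqP => // e; case: insubP => // r _ + [Er].
rewrite Er /= => -[/esym e1]; move/esym.
case eq2: (psteps q) => [|//]; case ep2: (psteps p) => [|//] _.
have e3 : pstart p = v by rewrite -e /pend eq2.
split; apply: val_inj; apply/eqP; rewrite -pair_eqE /=.
  by apply/andP; split; apply/eqP.
by apply/andP; split; apply/eqP.
Qed.

Variable K : fieldType.

(** The path algebra KQ: K-linear combinations of paths, the product of two
    paths being their composite, or 0 if they are not composable. *)
Definition pathalg := {malg K[qpath]}.
HB.instance Definition _ := GRing.Lmodule.on pathalg.

Definition pathU (p : qpath) : pathalg := << p >>.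

Definition bmul (p q : qpath) : pathalg :=
  if pcomp p q is Some r then pathU r else 0.

Definition pmul (x y : pathalg) : pathalg :=
  \sum_(p <- msupp x) \sum_(q <- msupp y) (x@_p * y@_q) *: bmul p q.

Definition pone : pathalg := \sum_v pathU (trivial_path v).

Lemma pmulEw (d1 d2 : {fset qpath}) x y : msupp x `<=` d1 -> msupp y `<=` d2 ->
  pmul x y = \sum_(p <- d1) \sum_(q <- d2) (x@_p * y@_q) *: bmul p q.
Proof.
move=> le1 le2; rewrite /pmul (big_fset_incl _ le1) /=; last first.
  move=> p _ /mcoeff_outdom xp.
  by rewrite big1 // => q _; rewrite xp mul0r scale0r.
apply: eq_bigr => p _; apply: big_fset_incl => // q _ /mcoeff_outdom ->.
by rewrite mulr0 scale0r.
Qed.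

Lemma pmulDl : left_distributive pmul +%R.
Proof.
move=> x y z.
rewrite (pmulEw (msuppD_le x y) (fsubset_refl (msupp z))).
rewrite (pmulEw (fsubsetUl (msupp x) (msupp y)) (fsubset_refl (msupp z))).
rewrite (pmulEw (fsubsetUr (msupp x) (msupp y)) (fsubset_refl (msupp z))).
rewrite -big_split; apply: eq_bigr => p _; rewrite -big_split.
by apply: eq_bigr => q _; rewrite mcoeffD mulrDl scalerDl.
Qed.

Lemma pmulDr : right_distributive pmul +%R.
Proof.
move=> z x y.
rewrite (pmulEw (fsubset_refl (msupp z)) (msuppD_le x y)).
rewrite (pmulEw (fsubset_refl (msupp z)) (fsubsetUl (msupp x) (msupp y))).
rewrite (pmulEw (fsubset_refl (msupp z)) (fsubsetUr (msupp x) (msupp y))).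
rewrite -big_split; apply: eq_bigr => p _; rewrite -big_split.
by apply: eq_bigr => q _; rewrite mcoeffD mulrDr scalerDl.
Qed.

Lemma pmulZl c x y : pmul (c *: x) y = c *: pmul x y.
Proof.
rewrite (pmulEw (msuppZ_le c x) (fsubset_refl (msupp y))) /pmul scaler_sumr.
apply: eq_bigr => p _; rewrite scaler_sumr; apply: eq_bigr => q _.
by rewrite mcoeffZ scalerA mulrA.
Qed.

Lemma pmulZr c x y : pmul x (c *: y) = c *: pmul x y.
Proof.
rewrite (pmulEw (fsubset_refl (msupp x)) (msuppZ_le c y)) /pmul scaler_sumr.
apply: eq_bigr => p _; rewrite scaler_sumr; apply: eq_bigr => q _.
by rewrite mcoeffZ scalerA mulrCA.
Qed.

Lemma pmul0l x : pmul 0 x = 0.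
Proof. by have := pmulZl 0 0 x; rewrite !scale0r. Qed.

Lemma pmul0r x : pmul x 0 = 0.
Proof. by have := pmulZr 0 x 0; rewrite !scale0r. Qed.

Lemma pmul_suml I (r : seq I) (F : I -> pathalg) y :
  pmul (\sum_(i <- r) F i) y = \sum_(i <- r) pmul (F i) y.
Proof. exact: (big_morph (pmul^~ y) (fun a b => pmulDl a b y) (pmul0l y)). Qed.

Lemma pmul_sumr I (r : seq I) (F : I -> pathalg) y :
  pmul y (\sum_(i <- r) F i) = \sum_(i <- r) pmul y (F i).
Proof. exact: (big_morph (pmul y) (fun a b => pmulDr y a b) (pmul0r y)). Qed.

Lemma pathalgE (x : pathalg) : x = \sum_(p <- msupp x) x@_p *: pathU p.
Proof.
rewrite [LHS]monalgE; apply: eq_bigr => p _; apply/malgP => q.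
by rewrite mcoeffZ !mcoeffU mulr_natr.
Qed.

Lemma pmulUU p q : pmul (pathU p) (pathU q) = bmul p q.
Proof.
rewrite (pmulEw msuppU_le msuppU_le) !big_seq_fset1 !mcoeffUU.
by rewrite mulr1 scale1r.
Qed.

Lemma pathalg_ind (P : pathalg -> Prop) :
  P 0 -> (forall c p x, P x -> P (c *: pathU p + x)) -> forall x, P x.
Proof.
move=> P0 Pstep x; rewrite [x]pathalgE.
have H (s : seq qpath) : P (\sum_(p <- s) x@_p *: pathU p).
  by elim: s => [|p s IHs]; rewrite ?big_nil // big_cons; apply: Pstep.
exact: H.
Qed.

Lemma pmulA : associative pmul.
Proof.
apply: (bilinear_assoc pathalg_ind pmulDl pmulDr pmulZl pmulZr) => p q r.
rewrite (pmulUU q r) (pmulUU p q); have := pcompA p q r.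
rewrite /bmul; case: (pcomp q r) => [s|]; case: (pcomp p q) => [t|] /= E.
- by rewrite (pmulUU p s) (pmulUU t r) /bmul E.
- by rewrite (pmulUU p s) (pmul0l (pathU r)) /bmul E.
- by rewrite (pmulUU t r) (pmul0r (pathU p)) /bmul -E.
- by rewrite (pmul0l (pathU r)) (pmul0r (pathU p)).
Qed.

Lemma pone_pathU_l p : pmul pone (pathU p) = pathU p.
Proof.
rewrite pmul_suml (bigD1 (pend p)) //= big1.
  by rewrite pmulUU /bmul pcomp_trivl eqxx addr0.
by move=> v nv; rewrite pmulUU /bmul pcomp_trivl eq_sym (negPf nv).
Qed.

Lemma pone_pathU_r p : pmul (pathU p) pone = pathU p.
Proof.
rewrite pmul_sumr (bigD1 (pstart p)) //= big1.
  by rewrite pmulUU /bmul pcomp_trivr eqxx addr0.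
by move=> v nv; rewrite pmulUU /bmul pcomp_trivr eq_sym (negPf nv).
Qed.

Lemma pmul1l : left_id pone pmul.
Proof.
move=> x; rewrite (pathalgE x) pmul_sumr; apply: eq_bigr => p _.
by rewrite pmulZr pone_pathU_l.
Qed.

Lemma pmul1r : right_id pone pmul.
Proof.
move=> x; rewrite (pathalgE x) pmul_suml; apply: eq_bigr => p _.
by rewrite pmulZl pone_pathU_r.
Qed.

HB.instance Definition _ := GRing.Zmodule_isPzRing.Build pathalg
  pmulA pmul1l pmul1r pmulDl pmulDr.

Lemma mcoeff_trivM v (x y : pathalg) :
  (x * y)@_(trivial_path v) = x@_(trivial_path v) * y@_(trivial_path v).
Proof.
apply: (bilinear_form pathalg_ind pmulDl pmulDr pmulZl pmulZr
          (phi := mcoeff (trivial_path v))) => [c a b|p q].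
  by rewrite mcoeffD mcoeffZ.
rewrite pmulUU !mcoeffU.
case: (eqVneq p (trivial_path v)) => [->|np] /=; last first.
  rewrite mul0r /bmul; case E: (pcomp p q) => [r|]; last by rewrite mcoeff0.
  rewrite mcoeffU; case: eqP => // Er.
  by move: np; rewrite Er in E; rewrite (pcomp_eq_triv E).1 eqxx.
case: (eqVneq q (trivial_path v)) => [->|nq] /=; last first.
  rewrite mulr0 /bmul; case E: (pcomp _ q) => [r|]; last by rewrite mcoeff0.
  rewrite mcoeffU; case: eqP => // Er.
  by move: nq; rewrite Er in E; rewrite (pcomp_eq_triv E).2 eqxx.
by rewrite /bmul pcomp_trivl /pend /= eqxx mcoeffU eqxx mulr1.
Qed.

Lemma mcoeff_triv1 v : (1 : pathalg)@_(trivial_path v) = 1.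
Proof.
change (pone@_(trivial_path v) = 1).
rewrite raddf_sum (bigD1 v) //= big1 ?addr0 ?mcoeffUU // => w nw.
rewrite mcoeffU; case: eqP => // /(congr1 pstart); rewrite /pstart /= => E.
by move: nw; rewrite E eqxx.
Qed.

End PathAlgebra.

Section Ideals.
Variable A : pzRingType.

Definition two_sided_ideal (I : A -> Prop) : Prop :=
  [/\ I 0, (forall x y, I x -> I y -> I (x + y))
    & (forall a x b, I x -> I (a * x * b))].

Definition ideal_gen (S : A -> Prop) (x : A) : Prop :=
  forall I, two_sided_ideal I -> (forall y, S y -> I y) -> I x.

Definition ideal_pow (I : A -> Prop) (N : nat) : A -> Prop :=
  ideal_gen (fun x => exists s : seq A,
    [/\ size s = N, (forall y, y \in s -> I y) & x = \prod_(y <- s) y]).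

End Ideals.

Definition arrow_ideal (Q : quiver) (K : fieldType) : pathalg Q K -> Prop :=
  ideal_gen (fun x => exists a : arrow Q, x = pathU K (arrow_path a)).

Section Modules.
Variables (Q : quiver) (K : fieldType).

(** Finite-dimensional left KQ-modules. With the above composition of paths,
    an arrow i -> j maps e_i M into e_j M. *)
Record fdmod := Fdmod {
  carrier :> vectType K;
  act : {linear pathalg Q K -> 'End(carrier)};
  act1 : act 1 = \1%VF;
  actM : forall x y, act (x * y) = (act x \o act y)%VF
}.

Definition is_hom (M N : fdmod) (f : 'Hom(M, N)) : Prop :=
  forall x m, f (act M x m) = act N x (f m).

Definition isomorphic (M N : fdmod) : Prop :=
  exists2 f : 'Hom(M, N), is_hom f & bijective f.

Definition submodule (M : fdmod) (U : {vspace M}) : Prop :=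
  forall x m, m \in U -> act M x m \in U.

Definition indecomposable (M : fdmod) : Prop :=
  fullv != 0%VS :> {vspace M} /\
  forall U V : {vspace M}, submodule U -> submodule V ->
    (U + V)%VS = fullv -> (U :&: V)%VS = 0%VS -> U = 0%VS \/ V = 0%VS.

Definition maximal_submodule (M : fdmod) (U : {vspace M}) : Prop :=
  [/\ submodule U, U != fullv
    & forall V : {vspace M}, submodule V -> (U <= V)%VS ->
        V = U \/ V = fullv].

Definition simple_submodule (M : fdmod) (U : {vspace M}) : Prop :=
  [/\ submodule U, U != 0%VS
    & forall V : {vspace M}, submodule V -> (V <= U)%VS ->
        V = 0%VS \/ V = U].

Definition in_radical (M : fdmod) (m : M) : Prop :=
  forall U : {vspace M}, maximal_submodule U -> m \in U.

(** The sum of the simple submodules, as the least subspace containing them. *)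
Definition in_socle (M : fdmod) (m : M) : Prop :=
  forall W : {vspace M},
    (forall U : {vspace M}, simple_submodule U -> (U <= W)%VS) -> m \in W.

(** M / rad M is isomorphic to S, stated without quotients: some surjection
    from M onto S has kernel rad M. *)
Definition has_top (M S : fdmod) : Prop :=
  exists f : 'Hom(M, S),
    [/\ is_hom f, limg f = fullv & forall m, m \in lker f <-> in_radical m].

(** soc M is isomorphic to S: some injection from S into M has image soc M. *)
Definition has_socle (M S : fdmod) : Prop :=
  exists f : 'Hom(S, M),
    [/\ is_hom f, lker f = 0%VS & forall m, m \in limg f <-> in_socle m].

Section SimpleModule.
Variable v : vertex Q.

Definition simple_act (x : pathalg Q K) : 'End(K^o) :=
  x@_(trivial_path v) *: \1%VF.

Lemma simple_act_linear : linear simple_act.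
Proof.
by move=> c x y; rewrite /simple_act mcoeffD mcoeffZ scalerDl scalerA.
Qed.

HB.instance Definition _ :=
  GRing.isLinear.Build K (pathalg Q K) 'End(K^o) *:%R simple_act
    simple_act_linear.

Lemma simple_act1 : simple_act 1 = \1%VF.
Proof. by rewrite /simple_act mcoeff_triv1 scale1r. Qed.

Lemma simple_actM x y : simple_act (x * y) = (simple_act x \o simple_act y)%VF.
Proof.
rewrite /simple_act mcoeff_trivM; apply/lfunP => k.
by rewrite comp_lfunE !scale_lfunE !id_lfunE scalerA.
Qed.

(** The simple module at v: K, with the trivial path at v acting as the identity
    and every other path as 0. *)
Definition simple_at : fdmod :=
  @Fdmod K^o simple_act simple_act1 simple_actM.

End SimpleModule.

Definition nilpotent_module (M : fdmod) : Prop :=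
  exists N, forall x, ideal_pow (@arrow_ideal Q K) N x -> act M x = 0.

(** Objects of the category of nilpotent finite-dimensional KQ-modules;
    for Q = Ã_n this is E_n. *)
Record nilmod := Nilmod {
  nilmod_mod :> fdmod;
  nilmodP : nilpotent_module nilmod_mod
}.

Definition iso_closed (D : nilmod -> Prop) : Prop :=
  forall M N : nilmod, isomorphic M N -> D M -> D N.

Definition short_exact (L M N : fdmod) (f : 'Hom(L, M)) (g : 'Hom(M, N)) :
    Prop :=
  [/\ is_hom f, is_hom g, lker f = 0%VS, limg f = lker g & limg g = fullv].

(** Full isomorphism-closed subcategories are given by their objects. *)
Definition torsion_pair (TF : (nilmod -> Prop) * (nilmod -> Prop)) : Prop :=
  let: (T, F) := TF in
  [/\ iso_closed T, iso_closed F,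
      forall X Y : nilmod, T X -> F Y -> forall f : 'Hom(X, Y), is_hom f -> f = 0
    & forall X : nilmod, exists (XT XF : nilmod) (f : 'Hom(XT, X)) (g : 'Hom(X, XF)),
        [/\ T XT, F XF & short_exact f g]].

Definition infinitely_many_indec (D : nilmod -> Prop) (P : fdmod -> Prop) :
    Prop :=
  exists M : nat -> nilmod,
    (forall k, [/\ D (M k), indecomposable (M k) & P (M k)]) /\
    (forall k l, k <> l -> ~ isomorphic (M k) (M l)).

Definition Lset (D : nilmod -> Prop) (v : vertex Q) : Prop :=
  infinitely_many_indec D (fun M => has_top M (simple_at v)).

Definition Rset (D : nilmod -> Prop) (v : vertex Q) : Prop :=
  infinitely_many_indec D (fun M => has_socle M (simple_at v)).

End Modules.

Section PartPartitions.
Variable Q : quiver.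
Implicit Types (O : {set vertex Q}) (v : vertex Q).

(** Sinks and sources of the full subquiver Q(O). *)
Definition sinks O : {set vertex Q} :=
  [set v in O | [forall a : arrow Q, ~~ ((src a == v) && (tgt a \in O))]].

Definition sources O : {set vertex Q} :=
  [set v in O | [forall a : arrow Q, ~~ ((tgt a == v) && (src a \in O))]].

(** A tuple Δ_0, Δ_1, ..., Δ_m is encoded as (Δ_0, [:: Δ_1; ...; Δ_m]). *)
Definition vtuple := ({set vertex Q} * seq {set vertex Q})%type.

Definition tlen (D : vtuple) : nat := size D.2.
Definition part (D : vtuple) (i : nat) : {set vertex Q} :=
  nth set0 (D.1 :: D.2) i.

(** Q_0 - Δ_0 - ... - Δ_(i-1) *)
Definition remaining (D : vtuple) (i : nat) : {set vertex Q} :=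
  ~: \bigcup_(j < i) part D j.

Definition disjoint_parts (D : vtuple) : Prop :=
  (forall i j, (i < j <= tlen D)%N -> [disjoint part D i & part D j]) /\
  (forall i, (0 < i <= tlen D)%N -> part D i != set0).

Definition strong1_part_partition (D : vtuple) : Prop :=
  disjoint_parts D /\
  forall i, (0 < i)%N ->
    ((2 * i - 1 <= tlen D)%N ->
       sinks (remaining D (2 * i - 1)) \subset part D (2 * i - 1)) /\
    ((2 * i <= tlen D)%N ->
       sources (remaining D (2 * i)) \subset part D (2 * i)).

Definition strong2_part_partition (D : vtuple) : Prop :=
  disjoint_parts D /\
  forall i, (0 < i)%N ->
    ((2 * i - 1 <= tlen D)%N ->
       sources (remaining D (2 * i - 1)) \subset part D (2 * i - 1)) /\
    ((2 * i <= tlen D)%N ->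
       sinks (remaining D (2 * i)) \subset part D (2 * i)).

Definition complete_parts (D : vtuple) : Prop :=
  \bigcup_(i < (tlen D).+1) part D i = setT.

End PartPartitions.

(* Main.v *)
Require Import Defs.
From HB Require Import structures.
From mathcomp Require Import all_boot all_order all_algebra.
From mathcomp Require Import finmap monalg.
From mathcomp Require Import zify.
From Stdlib Require Import ClassicalEpsilon FunctionalExtensionality.
From Stdlib Require Import PropExtensionality ProofIrrelevance.

(* Let x be the sum of the arrows and e_p the trivial path at p. A homomorphism
   from the uniserial module U(p,l) with top S_p and length l to Y is an element
   y of e_p Y with x^l y = 0. Since every nonzero nilpotent module has a uniserial
   module, of maximal length, both as a submodule and as a quotient, a torsion pair
   is determined by the set P of the (p,l) with U(p,l) torsion, and the sets that
   occur are those closed under shortening (quotients of U(p,l)) and under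
   (p,k), (p+k,l) |-> (p,k+l) (extensions).

   Such a P makes "P(q,d) and q + d = p" an ancestor relation on the vertices.
   If P contains no full ray {(p,l) | l}, the number r(p) of ancestors satisfies
   r(p+1) <= r(p) + 1, vanishes somewhere, and recovers P as the set of the (p,l)
   with r > r(p) on p+1, ..., p+l; if P contains full rays, their tops are first
   made roots, and become the zeros of r. Full rays in P are the elements of L_T,
   and R_F is nonempty exactly when there is none, so both sets of torsion pairs
   are in bijection with the same set of functions r.

   A complete strong part partition is the function lam sending a vertex to the
   index of its part, and its defining condition bounds the fall of lam between
   neighbours on one side, depending on the parity of the level. The set {lam >= m}
   is {r >= m} translated by the number of sink steps before step m. *)

Set Implicit Arguments.
Unset Strict Implicit.
Unset Printing Implicit Defensive.

Import GRing.Theory.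

(** Excluded middle turns propositions into booleans, so that [ex_minnP] and finite sets apply to
    them. *)
Definition asbool (A : Prop) : bool :=
  if excluded_middle_informative A then true else false.

Lemma asboolP (A : Prop) : reflect A (asbool A).
Proof. by rewrite /asbool; case: excluded_middle_informative => h; constructor. Qed.

(** * Modules from a multiplicative family of operators indexed by paths *)

Section PathModules.
Local Open Scope ring_scope.
Variables (Q : quiver) (K : fieldType) (V : vectType K).
Variable F : qpath Q -> 'End(V).
Hypothesis F1 : \sum_v F (trivial_path v) = \1%VF.
Hypothesis FM : forall p q,
  (F p \o F q)%VF = if Defs.pcomp p q is Some r then F r else 0.

Definition path_act (y : pathalg Q K) : 'End(V) :=
  \sum_(p <- msupp y) y@_p *: F p.

Lemma path_actEw (d : {fset qpath Q}) (y : pathalg Q K) : (msupp y `<=` d)%fset ->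
  path_act y = \sum_(p <- d) y@_p *: F p.
Proof.
move=> le; rewrite /path_act (big_fset_incl _ le) //= => p _ /mcoeff_outdom ->.
by rewrite scale0r.
Qed.

Lemma path_act_linear : linear path_act.
Proof.
move=> c x y.
rewrite (path_actEw (d := (msupp x `|` msupp y)%fset)); last first.
  apply: fsubset_trans (msuppD_le _ _) _; apply: fsetSU; exact: msuppZ_le.
rewrite (path_actEw (fsubsetUl (msupp x) (msupp y))).
rewrite (path_actEw (fsubsetUr (msupp x) (msupp y))).
rewrite scaler_sumr -big_split; apply: eq_bigr => p _.
by rewrite mcoeffD mcoeffZ scalerDl scalerA.
Qed.

HB.instance Definition _ :=
  GRing.isLinear.Build K (pathalg Q K) 'End(V) *:%R path_act path_act_linear.

Lemma path_actU p : path_act (pathU K p) = F p.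
Proof.
by rewrite (path_actEw msuppU_le) big_seq_fset1 mcoeffUU scale1r.
Qed.

Lemma path_act1 : path_act 1 = \1%VF.
Proof.
rewrite -F1; change (path_act (pone Q K) = \sum_v F (trivial_path v)).
by rewrite linear_sum; apply: eq_bigr => v _; exact: path_actU.
Qed.

(** Both sides are bilinear, so induction on x and then on y reduces to two paths, where the claim
    is [FM]. *)
Lemma path_actM x y : path_act (x * y) = (path_act x \o path_act y)%VF.
Proof.
have P0 : path_act 0 = 0 by exact: linear0.
rewrite -[x * y]/(pmul x y).
have linl (g f1 f2 : 'End(V)) (c : K) :
    c *: (f1 \o g)%VF + (f2 \o g)%VF = ((c *: f1 + f2) \o g)%VF.
  by apply/lfunP => v; rewrite !(comp_lfunE, add_lfunE, scale_lfunE).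
have linr (g f1 f2 : 'End(V)) (c : K) :
    c *: (g \o f1)%VF + (g \o f2)%VF = (g \o (c *: f1 + f2))%VF.
  by apply/lfunP => v; rewrite !(comp_lfunE, add_lfunE, scale_lfunE) linearP.
elim/pathalg_ind: x => [|c p x IHx]; first by rewrite pmul0l P0 comp_lfun0l.
have E1 : path_act (pmul (c *: pathU K p + x) y) =
    c *: path_act (pmul (pathU K p) y) + path_act (pmul x y).
  by rewrite pmulDl pmulZl; exact: path_act_linear.
apply: (eq_trans E1); rewrite (path_act_linear c (pathU K p) x) -linl.
congr (_ *: _ + _); last exact: IHx.
elim/pathalg_ind: y {E1 IHx} => [|d q y IHy]; first by rewrite pmul0r P0 comp_lfun0r.
have E2 : path_act (pmul (pathU K p) (d *: pathU K q + y)) =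
    d *: path_act (pmul (pathU K p) (pathU K q)) + path_act (pmul (pathU K p) y).
  by rewrite pmulDr pmulZr; exact: path_act_linear.
apply: (eq_trans E2); rewrite (path_act_linear d (pathU K q) y) -linr.
congr (_ *: _ + _); last exact: IHy.
transitivity (F p \o F q)%VF; last first.
  by congr (_ \o _)%VF; symmetry; exact: path_actU.
rewrite pmulUU FM /bmul; case: (Defs.pcomp p q) => [r|] //; exact: path_actU.
Qed.

Definition path_module : fdmod Q K :=
  @Fdmod Q K V path_act path_act1 path_actM.

End PathModules.

(* Locked, because conversion tests between distinct elements of the path
   algebra unfold the free module on paths and do not terminate in practice. *)
HB.lock Definition idem (n : nat) (K : fieldType)
    (M : fdmod (cyclic_quiver n) K) (i : 'I_n) : 'End(M) :=
  act M (pathU K (@trivial_path (cyclic_quiver n) i)).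

HB.lock Definition step (n : nat) (K : fieldType)
    (M : fdmod (cyclic_quiver n) K) : 'End(M) :=
  act M (\sum_(a : 'I_n) pathU K (@arrow_path (cyclic_quiver n) a))%R.

HB.lock Definition arr (n : nat) (K : fieldType)
    (M : fdmod (cyclic_quiver n) K) (i : 'I_n) : 'End(M) :=
  act M (pathU K (@arrow_path (cyclic_quiver n) i)).

(** * Modules over the cyclic quiver: graded spaces with an operator of degree one *)

Section Cyclic.
Local Open Scope ring_scope.
Variables (n : nat) (K : fieldType).
Local Notation Q := (cyclic_quiver n).
Local Notation mod_ := (fdmod Q K).

Section OneModule.
Variable M : mod_.
Implicit Types (m : M) (i j : 'I_n).

Lemma act_pathU (p q : qpath Q) m :
  act M (pathU K p) (act M (pathU K q) m) =
  if Defs.pcomp p q is Some r then act M (pathU K r) m else 0.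
Proof.
have E : act M (bmul K p q) m = act M (pathU K p) (act M (pathU K q) m).
  apply: (etrans _ (comp_lfunE (act M (pathU K p)) (act M (pathU K q)) m)); congr (fun_of_lfun _ m).
  apply: (etrans _ (@actM _ _ M (pathU K p) (pathU K q))); congr (act M _).
  by symmetry; exact: pmulUU.
apply: (etrans (esym E)); rewrite /bmul; case: (Defs.pcomp p q) => [r|] //.
have -> : act M 0 = 0 by exact: linear0.
exact: zero_lfunE.
Qed.

Lemma idem_idem i j m : idem M i (idem M j m) = if i == j then idem M j m else 0.
Proof.
rewrite idem.unlock; apply: (etrans (act_pathU _ _ m)).
have -> := @pcomp_trivl Q i (@trivial_path Q j).
have -> : pend (@trivial_path Q j) = j by [].
by rewrite eq_sym; case: ifP.
Qed.

Lemma sum_idem m : \sum_i idem M i m = m.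
Proof.
have := act1 M => /lfunP/(_ m); rewrite id_lfunE => E.
apply: etrans E; rewrite idem.unlock.
have -> : act M 1 = \sum_i act M (pathU K (@trivial_path Q i)) by exact: linear_sum.
by rewrite sum_lfunE.
Qed.

Lemma step_sum m : step M m = \sum_a arr M a m.
Proof.
rewrite step.unlock arr.unlock.
have -> : act M (\sum_(a : 'I_n) pathU K (@arrow_path Q a)) =
  \sum_(a : 'I_n) act M (pathU K (@arrow_path Q a)) by exact: linear_sum.
by rewrite sum_lfunE.
Qed.

Lemma arr_idem a i m : arr M a (idem M i m) = if a == i then arr M a m else 0.
Proof.
rewrite idem.unlock arr.unlock; apply: (etrans (act_pathU _ _ m)).
have -> := @pcomp_trivr Q i (@arrow_path Q a).
have -> : pstart (@arrow_path Q a) = a by [].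
by case: ifP.
Qed.

Lemma idem_arr a i m : idem M i (arr M a m) = if ordS a == i then arr M a m else 0.
Proof.
rewrite idem.unlock arr.unlock; apply: (etrans (act_pathU _ _ m)).
have -> := @pcomp_trivl Q i (@arrow_path Q a).
have -> : pend (@arrow_path Q a) = ordS a by [].
by case: ifP.
Qed.

Lemma step_idem_arr i m : step M (idem M i m) = arr M i m.
Proof.
rewrite step_sum (bigD1 i) //= arr_idem eqxx big1 ?addr0 // => a na.
by rewrite arr_idem (negPf na).
Qed.

(** Composing x with e_i on the right, or with e_(i+1) on the left, leaves only the arrow at i. *)
Lemma step_idem i m : step M (idem M i m) = idem M (ordS i) (step M m).
Proof.
rewrite step_idem_arr step_sum linear_sum (bigD1 i) //= idem_arr eqxx.
rewrite big1 ?addr0 // => a na; rewrite idem_arr; case: eqP => //.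
by move/(@ordS_inj n) => E; rewrite E eqxx in na.
Qed.

(** On the cyclic quiver a path is determined by its start and its length, so it acts as a power of
    x after an idempotent. Hence submodules and homomorphisms can be tested on the e_i and x
    alone. *)
Lemma act_path (p : qpath Q) m :
  act M (pathU K p) m = iter (size (psteps p)) (step M) (idem M (pstart p) m).
Proof.
case: p => [[v s] w]; rewrite /psteps /pstart /=.
elim: s v w m => [|a s IHs] v w m.
  rewrite idem.unlock; congr (fun_of_lfun (act M (pathU K _)) m).
  exact: val_inj.
have /andP [/eqP ev ws] : (src a == v) && walk (tgt a) s by exact: w.
pose p' : qpath Q := exist _ (tgt a, s) ws.
have Ep : Defs.pcomp p' (arrow_path a) = Some (exist _ (v, a :: s) w).
  have e : pend (arrow_path a) = pstart p' by [].
  have [r -> vr] := pcompP e; congr Some; apply: val_inj.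
  by move: ev; rewrite /= vr /= /pstart /= => ->.
have := act_pathU p' (arrow_path a) m; rewrite Ep => E; apply: (etrans (esym E)).
apply: (etrans (IHs _ ws _)); rewrite [size _ in RHS]/= iterSr.
congr (iter _ _ _); transitivity (idem M (ordS a) (arr M a m)).
  by rewrite arr.unlock.
have {}ev : a = v := ev; rewrite -{}ev /=.
by rewrite -step_idem_arr step_idem idem_idem eqxx.
Qed.

Lemma iter_step_idem k i m :
  iter k (step M) (idem M i m) = idem M (iter k (@ordS n) i) (iter k (step M) m).
Proof. by elim: k => //= k ->; rewrite step_idem. Qed.

Lemma iter_stepD k m m' : iter k (step M) (m + m') = iter k (step M) m + iter k (step M) m'.
Proof. by elim: k => //= k ->; rewrite linearD. Qed.

Lemma iter_stepZ k c m : iter k (step M) (c *: m) = c *: iter k (step M) m.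
Proof. by elim: k => //= k ->; rewrite linearZ. Qed.

Lemma iter_step0 k : iter k (step M) 0 = 0.
Proof. by elim: k => //= k ->; rewrite linear0. Qed.

Lemma iter_step_sum (I : Type) (r : seq I) (F : I -> M) k :
  iter k (step M) (\sum_(i <- r) F i) = \sum_(i <- r) iter k (step M) (F i).
Proof.
exact: (big_morph _ (fun a b => iter_stepD k a b) (iter_step0 k)).
Qed.

Lemma iter_step_ge k l m : (k <= l)%N ->
  iter k (step M) m = 0 -> iter l (step M) m = 0.
Proof. by move=> /subnK <- e; rewrite iterD e iter_step0. Qed.

Lemma act0 m : act M 0 m = 0.
Proof. by rewrite (_ : act M 0 = 0) ?zero_lfunE //; exact: linear0. Qed.

Lemma act_linear c x y m : act M (c *: x + y) m = c *: act M x m + act M y m.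
Proof.
have -> : act M (c *: x + y) = c *: act M x + act M y by exact: linearP.
by rewrite add_lfunE scale_lfunE.
Qed.

Lemma act_stable (U : {vspace M}) :
  (forall i m, m \in U -> idem M i m \in U) ->
  (forall m, m \in U -> step M m \in U) -> submodule U.
Proof.
move=> Ue Ux y m mU; elim/pathalg_ind: y => [|c p y IHy].
  by rewrite act0 mem0v.
rewrite act_linear memvD ?memvZ // act_path.
have : idem M (pstart p) m \in U by exact: Ue.
by elim: (size _) => //= k IHk w; apply/Ux/IHk.
Qed.

Lemma submodule_idem (U : {vspace M}) i m : submodule U -> m \in U -> idem M i m \in U.
Proof. by move=> sU mU; rewrite idem.unlock; exact: sU. Qed.

Lemma submodule_step (U : {vspace M}) m : submodule U -> m \in U -> step M m \in U.
Proof. by move=> sU mU; rewrite step.unlock; exact: sU. Qed.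

Lemma submodule_iter (U : {vspace M}) k m : submodule U -> m \in U ->
  iter k (step M) m \in U.
Proof. by move=> sU mU; elim: k => //= k; exact: submodule_step. Qed.

End OneModule.

Lemma hom_idem (M N : mod_) (f : 'Hom(M, N)) i m : is_hom f ->
  f (idem M i m) = idem N i (f m).
Proof. by move=> hf; rewrite idem.unlock; exact: hf. Qed.

Lemma hom_iter (M N : mod_) (f : 'Hom(M, N)) k m : is_hom f ->
  f (iter k (step M) m) = iter k (step N) (f m).
Proof. by move=> hf; elim: k => //= k <-; rewrite step.unlock; exact: hf. Qed.

Lemma is_homP (M N : mod_) (f : 'Hom(M, N)) :
  (forall i m, f (idem M i m) = idem N i (f m)) ->
  (forall m, f (step M m) = step N (f m)) -> is_hom f.
Proof.
move=> fe fx y m; elim/pathalg_ind: y => [|c p y IHy]; first by rewrite !act0 linear0.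
rewrite !act_linear linearP /= IHy; congr (_ *: _ + _); rewrite !act_path -fe.
by elim: (size _) => //= k <-; rewrite fx.
Qed.

End Cyclic.

(** * Nilpotency and Loewy length *)

Section Nilpotent.
Local Open Scope ring_scope.
Variables (n : nat) (K : fieldType).
Local Notation Q := (cyclic_quiver n).
Local Notation mod_ := (fdmod Q K).

Lemma idem_iter (M : mod_) k i m :
  idem M i (iter k (step M) m) = iter k (step M) (idem M (iter k (@ord_pred n) i) m).
Proof.
rewrite iter_step_idem; congr (idem M _ _).
elim: k i => // k IHk i.
by rewrite [iter k.+1 (@ord_pred n) i]iterSr iterS -IHk ord_predK.
Qed.

Definition nilpotent_on (M : mod_) L := forall m, iter L (step M) m = 0.

(** Since x lies in J, its power x^N lies in J^N and acts as zero. *)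
Lemma step_nilpotent (M : mod_) : nilpotent_module M ->
  exists N, nilpotent_on M N.
Proof.
case=> N H; exists N => m.
pose s : pathalg Q K := \sum_(a : 'I_n) pathU K (@arrow_path Q a).
have Js : @arrow_ideal Q K s.
  move=> J [J0 JD JM] JS; apply: (big_ind J) => // a _.
  by apply: JS; exists a.
have E k : act M (\prod_(y <- nseq k s) y) m = iter k (step M) m.
  elim: k => [|k IHk]; first by rewrite big_nil act1 id_lfunE.
  rewrite big_cons /= -IHk step.unlock.
  apply: etrans (comp_lfunE _ _ _); congr (fun_of_lfun _ m).
  exact: actM.
rewrite -E (H _ _) ?zero_lfunE // => J idJ JS; apply: JS; exists (nseq N s).
by split=> //; [rewrite size_nseq | move=> y; rewrite mem_nseq => /andP [_ /eqP ->]].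
Qed.

(** The elements of KQ that map each x^j M into x^(j+k) M form a two-sided ideal [I k]. The ideal
    [I 1] contains the arrows, hence J, so a product of N elements of J lies in [I N] and kills
    M. *)
Lemma nilpotent_of_step (M : mod_) N : nilpotent_on M N -> nilpotent_module M.
Proof.
move=> H; exists N.
pose I k (y : pathalg Q K) := forall j m,
  exists m', act M y (iter j (step M) m) = iter (j + k) (step M) m'.
have I0 y : I 0%N y.
  move=> j m; rewrite addn0.
  elim/pathalg_ind: y => [|c p y [m' IHy]].
    by exists 0; rewrite act0 iter_step0.
  exists (c *: iter (size (psteps p)) (step M)
     (idem M (iter j (@ord_pred n) (pstart p)) m) + m').
  rewrite act_linear IHy iter_stepD iter_stepZ.
  by rewrite act_path idem_iter -!iterD addnC.
have actMm x y m : act M (x * y) m = act M x (act M y m).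
  by apply: etrans (comp_lfunE _ _ _); congr (fun_of_lfun _ m); exact: actM.
have idI k : two_sided_ideal (I k).
  split=> [j m|x y Ix Iy j m|a x b Ix j m].
  - by exists 0; rewrite act0 iter_step0.
  - have [m1 E1] := Ix j m; have [m2 E2] := Iy j m.
    exists (m1 + m2); rewrite iter_stepD -E1 -E2.
    by have := act_linear 1 x y (iter j (step M) m); rewrite !scale1r.
  - rewrite !actMm; have [m1 ->] := I0 b j m; rewrite addn0.
    have [m2 ->] := Ix j m1.
    by have [m3 ->] := I0 a (j + k)%N m2; exists m3; rewrite addn0.
have J1 y : @arrow_ideal Q K y -> I 1%N y.
  move/(_ _ (idI 1%N)); apply=> _ [a ->] j m.
  rewrite act_path idem_iter /=; exists (idem M (iter j (@ord_pred n) a) m).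
  by rewrite addn1.
move=> x /(_ _ (idI N)) IN; apply/lfunP => m; rewrite zero_lfunE.
suff : I N x by case/(_ 0%N m) => m' /= ->; rewrite add0n H.
apply: IN => _ [s [<- Js ->]]; elim: s Js => [_|y s IHs Js] j w.
  by exists w; rewrite big_nil act1 id_lfunE addn0.
rewrite big_cons actMm.
have [|m1 ->] := IHs _ j w; first by move=> z zs; apply: Js; rewrite inE zs orbT.
have [|m2 ->] := J1 y _ (j + size s)%N m1; first by apply: Js; rewrite inE eqxx.
by exists m2; rewrite addn1 /= addnS.
Qed.

Lemma loewy_length (M : mod_) : nilpotent_module M ->
  exists2 L, nilpotent_on M L & forall k, nilpotent_on M k -> (L <= k)%N.
Proof.
move=> /step_nilpotent [N HN].
have exP : exists k, asbool (nilpotent_on M k) by exists N; apply/asboolP.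
by case: (ex_minnP exP) => L /asboolP HL min; exists L => // k /asboolP /min.
Qed.

(* A generator of a uniserial submodule of maximal length. *)
Lemma loewy_witness (M : mod_) L : nilpotent_on M L ->
  (forall k, nilpotent_on M k -> (L <= k)%N) -> (exists m : M, m != 0) ->
  exists p z, [/\ (0 < L)%N, idem M p z = z & iter L.-1 (step M) z != 0].
Proof.
case: L => [H _ [m]|L HL min _]; first by move: (H m) => /= ->; rewrite eqxx.
have [z0 nz0] : exists z0, iter L (step M) z0 != 0.
  apply: NNPP => nex; have := min L; rewrite ltnn; move/(_ _)/notF; apply=> m.
  by apply/eqP; case: eqP => // /eqP h; case: nex; exists m.
have [p np] : exists p, iter L (step M) (idem M p z0) != 0.
  apply: NNPP => nex; case/negP: nz0; rewrite -[z0]sum_idem.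
  rewrite iter_step_sum big1 // => i _; apply/eqP; case: eqP => // /eqP h; case: nex; by exists i.
by exists p, (idem M p z0); rewrite idem_idem eqxx.
Qed.

End Nilpotent.

(** * Homomorphisms out of a module of given Loewy length *)

Lemma linear_lfun (K : fieldType) (V W : vectType K) (f : V -> W) :
  linear f -> exists g : 'Hom(V, W), g =1 f.
Proof.
move=> lf; pose F : {linear V -> W} := HB.pack f (GRing.isLinear.Build K V W _ f lf).
by exists (linfun F) => x; rewrite lfunE.
Qed.

Section LoewyHom.
Local Open Scope ring_scope.
Variables (n : nat) (K : fieldType).
Local Notation Q := (cyclic_quiver n).
Local Notation mod_ := (fdmod Q K).

Lemma iter_ordS_inj k : injective (iter k (@ordS n)).
Proof. by elim: k => // k IHk i j /(@ordS_inj n) /IHk. Qed.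

Lemma iter_fixed_idem (M : mod_) k p i (z : M) : idem M p z = z ->
  idem M i (iter k (step M) z) =
  if i == iter k (@ordS n) p then iter k (step M) z else 0.
Proof.
by move=> zp; rewrite -[in LHS]zp iter_step_idem idem_idem -iter_step_idem zp.
Qed.

(* The map is m |-> \sum_j phi (x^j m) x^(L-1-j) y, where x is the sum of the
   arrows and phi is a functional supported at the vertex of x^(L-1) z; its value
   at z is y modulo the span of the x^j y with 0 < j. *)
Lemma loewy_hom (M N : mod_) L p (z : M) (y : N) :
  nilpotent_on M L -> (0 < L)%N -> idem M p z = z -> iter L.-1 (step M) z != 0 ->
  idem N p y = y -> iter L (step N) y = 0 ->
  exists2 f : 'Hom(M, N), is_hom f &
    forall W : {vspace N}, submodule W -> f z \in W -> y \in W.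
Proof.
case: L => // L HL _ zp /=; set u := iter L _ z => nu yp y0.
set q := iter L (@ordS n) p.
pose g (m : M) : K := coord [tuple u] ord0 (idem M q m).
have gD c m m' : g (c *: m + m') = c * g m + g m'.
  by rewrite /g linearP linearP.
have g0 : g 0 = 0 by rewrite /g !linear0.
have gu : g u = 1.
  have -> : g u = coord [tuple u] ord0 u.
    by rewrite /g (iter_fixed_idem L q zp) -/q; case: (q =P q).
  have := @coord_free _ _ _ [tuple u] ord0 ord0.
  by rewrite /= => -> //; rewrite seq1_free.
have ge i m : g (idem M i m) = if i == q then g m else 0.
  by rewrite /g idem_idem [q == i]eq_sym; case: (i =P q) => [->|_]; rewrite ?linear0.
pose F m := \sum_(j < L.+1) g (iter j (step M) m) *: iter (L - j) (step N) y.
have FE : exists f : 'Hom(M, N), f =1 F.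
  apply: linear_lfun => c m m'; rewrite /F scaler_sumr -big_split.
  apply: eq_bigr => j _ /=.
  by rewrite iter_stepD iter_stepZ gD scalerDl scalerA.
have {FE} [f FE] := FE; exists f.
  apply: is_homP => [i m|m]; rewrite !FE /F.
    rewrite linear_sum; apply: eq_bigr => j _; rewrite linearZ /=.
    rewrite iter_step_idem ge (iter_fixed_idem (L - j) i yp).
    have <- : (iter j (@ordS n) i == q) = (i == iter (L - j) (@ordS n) p).
      rewrite -[RHS](inj_eq (@iter_ordS_inj j)) -iterD subnKC //; exact: leq_ord.
    by case: ifP; rewrite ?scale0r ?scaler0.
  (* Both sums agree after a shift of the index; the two boundary terms vanish because x^(L+1) kills
     M and y. *)
  rewrite linear_sum big_ord_recr big_ord_recl /=.
  rewrite -iterSr HL g0 scale0r addr0 subn0 linearZ /= y0 scaler0 add0r.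
  apply: eq_bigr => j _; rewrite linearZ /= -[step N _]iterS /bump add1n subnSK //.
  by rewrite -[step M (iter _ _ _)]iterS iterSr.
(* Downward induction on k puts x^k y into W: x^k (f z) is x^k y plus multiples of higher x^i y, and
   x^(L+1) y = 0. *)
move=> W sW fzW; suff H d : forall k, (L.+1 <= k + d)%N -> iter k (step N) y \in W.
  by apply: (H L.+1 0%N).
elim: d => [|d IHd] k lek.
  by rewrite (iter_step_ge (k := L.+1)) ?mem0v // -[k]addn0.
have := submodule_iter k sW fzW; rewrite FE /F big_ord_recr /= subnn gu scale1r.
rewrite iter_stepD rpredDl //.
rewrite iter_step_sum; apply: memv_suml => j _; rewrite iter_stepZ memvZ //.
by rewrite -iterD; apply: IHd; have := ltn_ord j; lia.
Qed.

End LoewyHom.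

(** * Submodules and quotients as linear retracts *)

Section Retract.
Local Open Scope ring_scope.
Variables (Q : quiver) (K : fieldType) (M : fdmod Q K) (W : vectType K).
Variables (i : 'Hom(W, M)) (r : 'Hom(M, W)).
Hypothesis riK : cancel i r.
Hypothesis ractM : forall a b w,
  r (act M a (i (r (act M b (i w))))) = r (act M a (act M b (i w))).

(** One construction serves submodules and quotients: the condition [ractM] holds when the image of
    i is a submodule, and also when the kernel of r is one. *)
Definition retract_act (a : pathalg Q K) : 'End(W) := (r \o (act M a \o i))%VF.

Lemma retract_act_linear : linear retract_act.
Proof.
move=> c a b; rewrite /retract_act.
have -> : act M (c *: a + b) = c *: act M a + act M b by exact: linearP.
apply/lfunP => w; rewrite !(comp_lfunE, add_lfunE, scale_lfunE).
by rewrite linearP.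
Qed.

HB.instance Definition _ :=
  GRing.isLinear.Build K (pathalg Q K) 'End(W) *:%R retract_act retract_act_linear.

Lemma retract_act1 : retract_act 1 = \1%VF.
Proof. by apply/lfunP => w; rewrite /retract_act act1 !(comp_lfunE, id_lfunE) riK. Qed.

Lemma retract_actM a b : retract_act (a * b) = (retract_act a \o retract_act b)%VF.
Proof.
by apply/lfunP => w; rewrite /retract_act actM !comp_lfunE ractM.
Qed.

Definition retract_module : fdmod Q K :=
  @Fdmod Q K W retract_act retract_act1 retract_actM.

Lemma retract_moduleE a w : act retract_module a w = r (act M a (i w)).
Proof. by rewrite [LHS]comp_lfunE comp_lfunE. Qed.

Lemma retract_nilpotent : nilpotent_module M -> nilpotent_module retract_module.
Proof.
case=> N HN; exists N => x /HN x0; apply/lfunP => w.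
by rewrite retract_moduleE x0 !zero_lfunE linear0.
Qed.

End Retract.

Section SubQuotient.
Local Open Scope ring_scope.
Variables (Q : quiver) (K : fieldType) (M : nilmod Q K) (U : {vspace M}).
Hypothesis sU : submodule U.

(** The retraction r turns a homomorphism out of S into a linear map on M that is equivariant on U,
    which is the kind of map that [torsion_submodule] tests. *)
Lemma submodule_nilmod : exists (S : nilmod Q K) (i : 'Hom(S, M)) (r : 'Hom(M, S)),
  [/\ is_hom i, cancel i r, limg i = U &
      forall a m, m \in U -> r (act M a m) = act S a (r m)].
Proof.
pose W : vectType K := subvs_of U.
pose i : 'Hom(W, M) := linfun (vsval : W -> M).
pose r : 'Hom(M, W) := linfun (vsproj U).
have iE w : i w = vsval w by rewrite lfunE.
have rE m : r m = vsproj U m by rewrite lfunE.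
have riK : cancel i r by move=> w; rewrite rE iE vsvalK.
have irK m : m \in U -> i (r m) = m by move=> mU; rewrite rE iE vsprojK.
have iU w : i w \in U by rewrite iE subvsP.
have ractM a b w : r (act M a (i (r (act M b (i w))))) = r (act M a (act M b (i w))).
  by rewrite irK //; apply/sU/iU.
exists (Nilmod (retract_nilpotent riK ractM (nilmodP M))), i, r.
split=> // [a w||a m mU].
- by rewrite retract_moduleE irK //; apply: sU.
- apply/vspaceP => m; apply/memv_imgP/idP => [[w _ ->] //|mU].
  by exists (r m); rewrite ?memvf ?irK.
- by rewrite retract_moduleE irK.
Qed.

Lemma quotient_nilmod : exists (S : nilmod Q K) (r : 'Hom(M, S)),
  [/\ is_hom r, limg r = fullv & lker r = U].
Proof.
pose W : vectType K := subvs_of (U^C)%VS.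
pose i : 'Hom(W, M) := linfun (vsval : W -> M).
pose r : 'Hom(M, W) := (linfun (vsproj (U^C)) \o daddv_pi (U^C) U)%VF.
have iE w : i w = vsval w by rewrite lfunE.
have disj : (U^C :&: U = 0)%VS by rewrite capvC capv_compl.
have rE m : r m = vsproj (U^C) (daddv_pi (U^C) U m) by rewrite comp_lfunE lfunE.
have irE m : i (r m) = daddv_pi (U^C) U m by rewrite iE rE vsprojK // memv_pi.
have riK : cancel i r by move=> w; rewrite rE iE daddv_pi_id ?vsvalK // subvsP.
have dec m : m = i (r m) + daddv_pi U (U^C) m.
  by rewrite irE daddv_pi_add // addvC addv_complf memvf.
have r0 m : m \in U -> r m = 0.
  move=> mU; have := dec m; rewrite daddv_pi_id ?capv_compl // => E.
  rewrite -(riK (r m)) (_ : i (r m) = 0) ?linear0 //.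
  by apply: (addIr m); rewrite -E add0r.
have ract a m : r (act M a (i (r m))) = r (act M a m).
  by rewrite [in RHS](dec m) !linearD /= [X in _ + X]r0 ?addr0 //; apply/sU/memv_pi.
have ractM a b w : r (act M a (i (r (act M b (i w))))) = r (act M a (act M b (i w))).
  exact: ract.
exists (Nilmod (retract_nilpotent riK ractM (nilmodP M))), r.
split=> [a m||].
- by rewrite retract_moduleE ract.
- by apply/vspaceP => w; rewrite memvf -(riK w) memv_img ?memvf.
- apply/vspaceP => m; rewrite memv_ker; apply/eqP/idP => [m0|/r0 //].
  by rewrite (dec m) m0 linear0 add0r memv_pi.
Qed.

End SubQuotient.

(** * Isomorphisms and orthogonality in a torsion pair *)

Section Isomorphisms.
Local Open Scope ring_scope.
Variables (Q : quiver) (K : fieldType).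
Implicit Types (M N : nilmod Q K).

Lemma hom_iso (M N : fdmod Q K) (f : 'Hom(M, N)) :
  is_hom f -> lker f = 0%VS -> limg f = fullv -> isomorphic M N.
Proof.
move=> hf /eqP k0 im; exists f => //; exists (f^-1)%VF.
  exact: lker0_lfunK.
by move=> y; apply: limg_lfunVK; rewrite im memvf.
Qed.

Lemma iso_sym (M N : fdmod Q K) : isomorphic M N -> isomorphic N M.
Proof.
case=> f hf [g fK gK]; have [g' g'E] : exists g' : 'Hom(N, M), g' =1 g.
  apply: linear_lfun => c x y; apply: (can_inj fK).
  by rewrite gK linearP /= !gK.
exists g'; last by exists f => x; rewrite g'E.
by move=> a y; apply: (can_inj fK); rewrite !g'E gK hf gK.
Qed.

Section TorsionPair.
Variables (T F : nilmod Q K -> Prop).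
Hypothesis TF : torsion_pair (T, F).

Lemma torsion_hom0 M N (f : 'Hom(M, N)) : T M -> F N -> is_hom f -> f = 0.
Proof. by case: TF => _ _ H _; move=> TM FN; exact: H. Qed.

(** If M has no nonzero map to F, the projection onto its torsion-free quotient is zero, so M is its
    own torsion part. *)
Lemma torsionE M : T M <->
  forall N, F N -> forall f : 'Hom(M, N), is_hom f -> f = 0.
Proof.
case: TF => isoT _ H0 ex; split=> [TM N FN|H]; first exact: H0.
have [XT [XF [f [g [TX FX [hf hg kf fg img]]]]]] := ex M.
apply: isoT TX; apply: (hom_iso hf kf); rewrite fg.
by rewrite (H _ FX g hg); apply/vspaceP => m; rewrite memv_ker zero_lfunE eqxx memvf.
Qed.

(** The torsion part of M will do: if it were zero, M would be isomorphic to its torsion-free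
    quotient. *)
Lemma torsionfree_sub M : ~ F M ->
  exists N (f : 'Hom(N, M)), [/\ T N, is_hom f, lker f = 0%VS & exists m : N, m != 0].
Proof.
case: TF => _ isoF _ ex nF.
have [XT [XF [f [g [TX FX [hf hg kf fg img]]]]]] := ex M.
exists XT, f; split=> //; apply: NNPP => no; apply: nF.
apply: isoF FX; apply/iso_sym/(hom_iso hg) => //.
apply/eqP; rewrite -fg -subv0; apply/subvP => _ /memv_imgP [m _ ->].
by case: (eqVneq m 0) => [->|nm]; [rewrite linear0 mem0v | case: no; exists m].
Qed.

End TorsionPair.
End Isomorphisms.

(** * Torsion pairs and extension-closed data *)

Section Data.
Local Open Scope ring_scope.
Variables (n : nat) (K : fieldType).
Local Notation Q := (cyclic_quiver n).
Local Notation nmod := (nilmod Q K).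
Implicit Types (P : 'I_n -> nat -> Prop) (F T : nmod -> Prop) (p q : 'I_n).

(* [P p l] stands for "the uniserial module of length l with top S_p is torsion";
   homomorphisms from that module to Y are the y in e_p Y with x^l y = 0. *)
Definition datum F : 'I_n -> nat -> Prop := fun p l =>
  forall Y, F Y -> forall y : Y, idem Y p y = y -> iter l (step Y) y = 0 -> y = 0.

Definition torsionfree_of P : nmod -> Prop := fun Y =>
  forall p l, P p l -> forall y : Y, idem Y p y = y -> iter l (step Y) y = 0 -> y = 0.

Definition torsion_of P : nmod -> Prop := fun X =>
  forall Y, torsionfree_of P Y -> forall f : 'Hom(X, Y), is_hom f -> f = 0.

(** Closure of a torsion class under quotients and extensions, read on uniserial modules: U(p,k) is
    a quotient of U(p,l) for k <= l, and U(p,k+l) is an extension of U(p,k) by its submodule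
    U(p+k,l). *)
Record extension_closed P : Prop := ExtensionClosed {
  closed0 : forall p, P p 0%N;
  closed_le : forall p k l, (k <= l)%N -> P p l -> P p k;
  closedD : forall p k l, P p k -> P (iter k (@ordS n) p) l -> P p (k + l)%N
}.

Lemma datum_closed F : extension_closed (datum F).
Proof.
split=> [p Y _ y _ //|p k l kl Hl Y FY y yp yk|p k l Hk Hl Y FY y yp ykl].
  by apply: (Hl Y FY y yp); exact: iter_step_ge kl yk.
apply: (Hk Y FY y yp); apply: (Hl Y FY).
  by rewrite (iter_fixed_idem k _ yp) eqxx.
by rewrite -iterD addnC.
Qed.

(** A Y outside F has a nonzero torsion submodule X. If z generates a uniserial submodule of X of
    maximal length L, [loewy_hom] shows that an element of e_p N killed by x^L vanishes for every N
    in F, so (p,L) is in the datum; the image of z in Y then contradicts the condition on Y. Finally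
    T is recovered from F by orthogonality. *)
Lemma torsion_pairE T F : torsion_pair (T, F) ->
  T = torsion_of (datum F) /\ F = torsionfree_of (datum F).
Proof.
move=> TF; have FE : F = torsionfree_of (datum F).
  apply: functional_extensionality => Y; apply: propositional_extensionality.
  split=> [FY p l Ppl y yp yl|H]; first exact: Ppl FY y yp yl.
  apply: NNPP => nF; have [X [f [TX hf kf nX]]] := torsionfree_sub TF nF.
  have [L HL minL] := loewy_length (nilmodP X).
  have [p [z [L0 zp nz]]] := loewy_witness HL minL nX.
  have PpL : datum F p L.
    move=> N FN y yp yL; have [g hg gz] := loewy_hom HL L0 zp nz yp yL.
    apply/eqP; rewrite -memv0; apply: gz.
      by move=> a m; rewrite memv0 => /eqP ->; rewrite linear0 mem0v.
    by rewrite (torsion_hom0 TF TX FN hg) zero_lfunE mem0v.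
  have : z = 0.
    move/eqP/lker0P: kf; apply; rewrite linear0.
    apply: (H _ _ PpL); first by rewrite -hom_idem // zp.
    by rewrite -hom_iter // HL linear0.
  by move=> z0; move: nz; rewrite z0 iter_step0 eqxx.
split=> //; apply: functional_extensionality => X; apply: propositional_extensionality.
by rewrite (torsionE TF) /torsion_of -FE.
Qed.

Section TorsionPart.
Variables (P : 'I_n -> nat -> Prop) (X : nmod).

(** This says that V, as a module, lies in [torsion_of P]; linear maps on X that are equivariant on
    V stand for homomorphisms out of V. *)
Definition torsion_submodule (V : {vspace X}) : Prop := submodule V /\
  forall Y, torsionfree_of P Y -> forall g : 'Hom(X, Y),
    (forall a m, m \in V -> g (act X a m) = act Y a (g m)) ->
    forall m, m \in V -> g m = 0.

(** This says on representatives that X/V lies in [torsionfree_of P]. *)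
Definition torsionfree_quotient (V : {vspace X}) : Prop :=
  forall p l m, P p l -> idem X p m = m -> iter l (step X) m \in V -> m \in V.

(** An element m that violates torsion-freeness of X/V is adjoined together with its x^j m. A map
    that is equivariant on the sum W vanishes on V, hence sends m to an element of e_p Y killed by
    x^l, which is zero. *)
Lemma torsion_submodule_grow (V : {vspace X}) :
  torsion_submodule V -> ~ torsionfree_quotient V ->
  exists2 W, torsion_submodule W & (\dim V < \dim W)%N.
Proof.
case=> sV tV nfree.
have [p [l [m [Ppl mp ml nm]]]] : exists p l m,
    [/\ P p l, idem X p m = m, iter l (step X) m \in V & m \notin V].
  apply: NNPP => no; apply: nfree => p l m Ppl mp ml.
  by apply: contraT => nm; case: no; exists p, l, m.
pose s := [seq iter j (step X) m | j <- iota 0 l].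
pose W := (V + <<s>>)%VS.
have VW : (V <= W)%VS by exact: addvSl.
have mjW j : iter j (step X) m \in W.
  case: (ltnP j l) => [jl|lj].
    apply: (subvP (addvSr _ _)); apply: memv_span; apply/mapP; exists j => //.
    by rewrite mem_iota.
  apply: (subvP VW); rewrite -(subnK lj) iterD; exact: submodule_iter.
have stab (h : 'End(X)) : (forall v, v \in V -> h v \in V) ->
    (forall j, h (iter j (step X) m) \in W) -> forall w, w \in W -> h w \in W.
  move=> hV hm w wW; suff /subvP sub : (h @: W <= W)%VS by exact: sub (memv_img _ wW).
  rewrite limgD subv_add; apply/andP; split.
    by apply: subv_trans VW; apply/subvP => _ /memv_imgP [v vV ->]; exact: hV.
  rewrite limg_span; apply/span_subvP => _ /mapP [_ /mapP [j _ ->] ->]; exact: hm.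
have sW : submodule W.
  apply: act_stable => [i|]; apply: stab => [v vV|j].
  - exact: submodule_idem.
  - by rewrite (iter_fixed_idem j i mp); case: ifP; rewrite ?mem0v ?mjW.
  - exact: submodule_step.
  - exact: (mjW j.+1).
exists W; last first.
  rewrite ltn_neqAle dimvS // andbT; apply/eqP => E.
  have /eqP VE : (V == W)%VS by rewrite eqEdim VW E leqnn.
  by case/negP: nm; rewrite VE; exact: (mjW 0%N).
split=> // Y FY g hg.
have gV v : v \in V -> g v = 0.
  by apply: (tV Y FY g) => a w wV; apply/hg/(subvP VW).
have gstep w : w \in W -> g (step X w) = step Y (g w).
  by rewrite step.unlock; exact: hg.
have giter j : g (iter j (step X) m) = iter j (step Y) (g m).
  by elim: j => //= j <-; rewrite gstep ?mjW.
have gm0 : g m = 0.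
  apply: (FY _ _ Ppl); last by rewrite -giter gV.
  by rewrite -[in RHS]mp idem.unlock; symmetry; exact/hg/(mjW 0%N).
suff /subvP sub : (W <= lker g)%VS by move=> w /sub; rewrite memv_ker => /eqP.
rewrite subv_add; apply/andP; split.
  by apply/subvP => v vV; rewrite memv_ker gV.
apply/span_subvP => _ /mapP [j _ ->].
by rewrite memv_ker giter gm0 iter_step0.
Qed.

(** Starting from 0, the submodule grows until its quotient is torsion-free; the induction is on its
    codimension. *)
Lemma torsion_part : exists V, torsion_submodule V /\ torsionfree_quotient V.
Proof.
suff H k V : torsion_submodule V -> (\dim {:X} - \dim V <= k)%N ->
    exists V, torsion_submodule V /\ torsionfree_quotient V.
  apply: (H _ 0%VS) (leqnn _); split=> [a m|Y _ g _ m]; rewrite memv0 => /eqP ->.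
    by rewrite linear0 mem0v.
  by rewrite linear0.
elim: k V => [|k IHk] V tV dV.
all: case: (classic (torsionfree_quotient V)) => [fV|nfV]; first by exists V.
all: have [W tW dW] := torsion_submodule_grow tV nfV.
all: have := dimvS (subvf W).
  by move: dV dW; lia.
by move=> le; apply: (IHk W tW); move: dV dW; lia.
Qed.

End TorsionPart.

Lemma torsion_pair_of P : torsion_pair (torsion_of P, torsionfree_of P).
Proof.
split.
- move=> M N [f hf [g fK gK]] TM Y FY h hh.
  apply/lfunP => y; rewrite -(gK y) zero_lfunE.
  have := TM Y FY (h \o f)%VF; move/(_ _)/lfunP/(_ (g y)).
  rewrite comp_lfunE zero_lfunE; apply=> a m.
  by rewrite !comp_lfunE hf hh.
- move=> M N [f hf [g fK gK]] FM p l Ppl y yp yl.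
  rewrite -(gK y); suff -> : g y = 0 by rewrite linear0.
  apply: (FM p l Ppl); apply: (can_inj fK).
    by rewrite hom_idem // gK.
  by rewrite hom_iter // gK yl linear0.
- by move=> X Y TX FY f; exact: TX.
move=> X; have [V [[sV tV] fV]] := torsion_part P X.
have [S [i [r [hi ir im hr]]]] := submodule_nilmod sV.
have [S' [q [hq iq kq]]] := quotient_nilmod sV.
exists S, S', i, q; split=> [Y FY f hf|p l Ppl y yp yl|].
- apply/lfunP => w; rewrite zero_lfunE.
  have := tV Y FY (f \o r)%VF _ (i w); rewrite comp_lfunE ir; apply.
    by move=> a m mV; rewrite !comp_lfunE hr // hf.
  by rewrite -im memv_img ?memvf.
- have /memv_imgP [m _ ym] : y \in limg q by rewrite iq memvf.
  have ym' : y = q (idem X p m) by rewrite hom_idem // -ym yp.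
  have : idem X p m \in V.
    apply: (fV p l _ Ppl); first by rewrite idem_idem eqxx.
    by rewrite -kq memv_ker hom_iter // -ym' yl.
  by rewrite -kq memv_ker ym' => /eqP.
- split=> //; last by rewrite im kq.
  by apply/eqP/lker0P; exact: can_inj ir.
Qed.

End Data.

(** * Construction of the uniserial modules *)

Section CyclicModule.
Local Open Scope ring_scope.
Variables (n : nat) (K : fieldType).
Local Notation Q := (cyclic_quiver n).
Variables (V : vectType K) (E : 'I_n -> 'End(V)) (X : 'End(V)).
Hypothesis EE : forall i j m, E i (E j m) = if i == j then E j m else 0.
Hypothesis E1 : forall m, \sum_i E i m = m.
Hypothesis XE : forall i m, X (E i m) = E (ordS i) (X m).

Let path_lfun (p : qpath Q) : 'End(V) :=
  (iter (size (psteps p)) (comp_lfun X) \1 \o E (pstart p))%VF.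

Let path_lfunE p m : path_lfun p m = iter (size (psteps p)) X (E (pstart p) m).
Proof.
rewrite comp_lfunE; elim: (size _) => [|k /= <-]; first by rewrite id_lfunE.
by rewrite comp_lfunE.
Qed.

Lemma pend_iter (p : qpath Q) :
  pend p = iter (size (psteps p)) (@ordS n) (pstart p).
Proof.
case: p => [[v s] w]; rewrite /pend /psteps /pstart /=.
elim: s v w => // a s IHs v w.
have /andP [/eqP ev ws] : (src a == v) && walk (tgt a) s by exact: w.
have {}ev : a = v := ev; rewrite [size _]/= iterSr -[in RHS]ev; exact: (IHs _ ws).
Qed.

Let XiterE k i m : iter k X (E i m) = E (iter k (@ordS n) i) (iter k X m).
Proof. by elim: k => //= k ->; rewrite XE. Qed.

Let Xiter0 k : iter k X 0 = 0.
Proof. by elim: k => //= k ->; rewrite linear0. Qed.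

Let path_lfunM p q : (path_lfun p \o path_lfun q)%VF =
  if Defs.pcomp p q is Some r then path_lfun r else 0.
Proof.
apply/lfunP => m; rewrite comp_lfunE !path_lfunE (XiterE (size (psteps q))) EE.
rewrite -XiterE -pend_iter [pstart p == _]eq_sym.
case: (pend q =P pstart p) => [e|/eqP ne]; last first.
  by rewrite Xiter0 /Defs.pcomp (negPf ne) zero_lfunE.
have [r -> vr] := pcompP e; rewrite path_lfunE /pstart /psteps vr /=.
by rewrite size_cat addnC iterD.
Qed.

Let path_lfun1 : \sum_v path_lfun (@trivial_path Q v) = \1%VF.
Proof.
apply/lfunP => m; rewrite sum_lfunE id_lfunE -[RHS]E1.
by apply: eq_bigr => i _; rewrite path_lfunE.
Qed.

(** Converse of [act_path]: letting a path act as the power of X given by its length, after E at its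
    start, defines a module. *)
Lemma cyclic_module : (exists N, forall m, iter N X m = 0) ->
  exists (M : nilmod Q K) (f : 'Hom(V, M)), bijective f /\
    (forall i m, idem M i (f m) = f (E i m)) /\ (forall m, step M (f m) = f (X m)).
Proof.
case=> N XN; pose M := path_module path_lfun1 path_lfunM.
have actU p m : act M (pathU K p) m = path_lfun p m.
  by congr (fun_of_lfun _ m); exact: path_actU.
have stepM m : step M m = X m.
  rewrite (step_sum (M := M)); apply: (etrans _ (congr1 X (E1 m))); rewrite linear_sum.
  apply: eq_bigr => i _; rewrite arr.unlock.
  by apply: (etrans (actU _ _)); rewrite path_lfunE.
have nil : nilpotent_on M N by move=> m; rewrite -[RHS](XN m); elim: (N) => //= k ->.
exists (Nilmod (nilpotent_of_step nil)), \1%VF; split.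
  by exists id => m; rewrite id_lfunE.
split=> [i m|m]; rewrite !id_lfunE; last exact: stepM.
by rewrite idem.unlock; apply: (etrans (actU _ _)); rewrite path_lfunE.
Qed.

End CyclicModule.

Section Uniserial.
Local Open Scope ring_scope.
Variables (n : nat) (K : fieldType).
Local Notation Q := (cyclic_quiver n).

(* U is the uniserial module with basis b_0, ..., b_(l-1), where b_0 generates
   its top S_p and b_(k+1) = x b_k; [co m k] is the coordinate of m on b_k. *)
Record is_uniserial (p : 'I_n) (l : nat) (U : fdmod Q K) (co : U -> nat -> K) :
    Prop := IsUniserial {
  co_linear : forall c m m' k, co (c *: m + m') k = c * co m k + co m' k;
  co_ge : forall m k, (l <= k)%N -> co m k = 0;
  co_inj : forall m m', co m =1 co m' -> m = m';
  co_surj : forall f : nat -> K, exists m, forall k, (k < l)%N -> co m k = f k;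
  co_idem : forall i m k,
    co (idem U i m) k = if iter k (@ordS n) p == i then co m k else 0;
  co_step : forall m k,
    co (step U m) k = if k is k'.+1 then (if (k < l)%N then co m k' else 0) else 0
}.

(** On row vectors of length l, x is the truncated shift and e_i keeps the coordinates k with p + k
    = i. *)
Lemma uniserial_exists p l :
  exists (U : nilmod Q K) (co : U -> nat -> K), is_uniserial p l co.
Proof.
pose V : vectType K := 'rV[K]_l.
pose co (m : V) k : K := if insub k is Some j then m ord0 j else 0.
have co_lt m k (kl : (k < l)%N) : co m k = m ord0 (Ordinal kl).
  by rewrite /co insubT.
have co_out m k : (l <= k)%N -> co m k = 0.
  by move=> lk; rewrite /co insubF // ltnNge lk.
have coL c m m' k : co (c *: m + m') k = c * co m k + co m' k.
  case: (ltnP k l) => kl; first by rewrite !co_lt !mxE.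
  by rewrite !co_out // mulr0 addr0.
have coI m m' : co m =1 co m' -> m = m'.
  move=> e; apply/rowP => j; have := e j; rewrite !(co_lt _ _ (ltn_ord j)).
  by rewrite (_ : Ordinal _ = j) //; apply: val_inj.
pose mk (f : nat -> K) : V := \row_(j < l) f j.
have coK f k : co (mk f) k = if (k < l)%N then f k else 0.
  by case: (ltnP k l) => kl; [rewrite co_lt mxE | rewrite co_out].
have lin (g : V -> nat -> K) :
    (forall c m m' k, g (c *: m + m') k = c * g m k + g m' k) ->
    exists G : 'End(V), forall m k, co (G m) k = if (k < l)%N then g m k else 0.
  move=> gL; have [|G GE] := @linear_lfun K V V (fun m => mk (g m)).
    by move=> c m m'; apply: coI => k; rewrite coL !coK gL; case: ifP; rewrite ?mulr0 ?addr0.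
  by exists G => m k; rewrite GE coK.
pose ge i m k := if iter k (@ordS n) p == i then co m k else 0.
have /fin_all_exists [E EE] i : exists G : 'End(V), forall m k,
    co (G m) k = if (k < l)%N then ge i m k else 0.
  by apply: lin => c m m' k; rewrite /ge; case: ifP; rewrite ?coL ?mulr0 ?addr0.
have {}EE i m k : co (E i m) k = ge i m k.
  rewrite EE /ge; case: ltnP => // lk; rewrite co_out //; by case: ifP.
pose gx m k := if k is k'.+1 then co m k' else 0.
have [X XX] : exists G : 'End(V), forall m k,
    co (G m) k = if (k < l)%N then gx m k else 0.
  by apply: lin => c m m' [|k] /=; rewrite ?coL ?mulr0 ?addr0.
have {}XX m k : co (X m) k =
    if k is k'.+1 then (if (k < l)%N then co m k' else 0) else 0.
  by rewrite XX; case: k => //=; case: ifP.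
have co0 k : co 0 k = 0 by rewrite /co; case: insub => // j; rewrite mxE.
have [|m|i m||U [f [fb [fE fX]]]] := @cyclic_module n K V E X.
- move=> i j m; apply: coI => k; rewrite EE /ge EE /ge.
  case: (i =P j) => [<-|ne]; first by rewrite EE /ge; case: (_ == i).
  by rewrite co0; case: eqP => // ->; case: eqP.
- apply: coI => k; rewrite (_ : co _ k = \sum_i ge i m k).
    rewrite (bigD1 (iter k (@ordS n) p)) //= /ge eqxx big1 ?addr0 // => i.
    by rewrite eq_sym => /negPf ->.
  have sumco (r : seq 'I_n) : co (\sum_(i <- r) E i m) k = \sum_(i <- r) ge i m k.
    elim: r => [|i r IHr]; first by rewrite !big_nil co0.
    by rewrite !big_cons -[E i m]scale1r coL mul1r EE IHr.
  exact: sumco.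
- apply: coI => k; rewrite XX EE /ge XX; case: k => [|k]; first by case: ifP.
  by rewrite EE /ge /= (inj_eq (@ordS_inj n)); case: ifP; case: ifP.
- exists l => m; apply: coI => k; rewrite co0.
  suff H d : co (iter d X m) k = if (d <= k)%N && (k < l)%N then co m (k - d)%N else 0.
    by rewrite H andbC; case: (ltnP k l).
  elim: d k => [|d IHd] k.
    by rewrite /= subn0; case: ltnP => // /co_out.
  rewrite /= XX; case: k => // k; rewrite IHd ltnS subSS.
  by case: (ltnP k.+1 l) => kl; rewrite ?andbT ?andbF // (ltnW kl) andbT.
case: fb => g fK gK.
have gL c x y : g (c *: x + y) = c *: g x + g y.
  by apply: (can_inj fK); rewrite gK linearP /= !gK.
exists U, (fun m => co (g m)); split=> [c m m' k|m k|m m' e|h|i m k|m k].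
- by rewrite gL coL.
- exact: co_out.
- by rewrite -(gK m) -(gK m') (coI _ _ e).
- by exists (f (mk h)) => k kl; rewrite fK coK kl.
- by rewrite -[m in LHS]gK fE fK EE.
- by rewrite -[m in LHS]gK fX fK XX.
Qed.

End Uniserial.

(** * Submodules, torsion and length of uniserial modules *)

Section UniserialTheory.
Local Open Scope ring_scope.
Variables (n : nat) (K : fieldType).
Local Notation Q := (cyclic_quiver n).
Variables (p : 'I_n) (l : nat) (U : nilmod Q K) (co : U -> nat -> K).
Hypothesis Uco : is_uniserial p l co.

Lemma co0 k : co 0 k = 0.
Proof. by have := co_linear Uco (-1) 0 0 k; rewrite scaler0 addr0 mulN1r addNr. Qed.

Lemma coZ c m k : co (c *: m) k = c * co m k.
Proof. by have := co_linear Uco c m 0 k; rewrite addr0 co0 addr0. Qed.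

Lemma co_neq0 m : m != 0 ->
  exists j, [/\ (j < l)%N, co m j != 0 & forall k, (k < j)%N -> co m k = 0].
Proof.
move=> nm; have exj : exists j, co m j != 0.
  apply: NNPP => no; case/eqP: nm; apply: (co_inj Uco) => k; rewrite co0.
  by apply/eqP/negP => /negP h; apply: no; exists k.
case: (ex_minnP exj) => j nj min; exists j; split=> // [|k kj].
  by rewrite ltnNge; apply: contra nj => lj; rewrite (co_ge Uco).
by apply/eqP; apply: contraTT kj => /min; rewrite leqNgt.
Qed.

Lemma co_iter d m k : co (iter d (step U) m) k =
  if (d <= k < l)%N then co m (k - d)%N else 0.
Proof.
elim: d k => [|d IHd] k; first by rewrite /= subn0; case: ltnP => // /(co_ge Uco) ->.
rewrite /= (co_step Uco); case: k => // k; rewrite IHd subSS ltnS.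
by case: (ltnP k.+1 l) => kl; rewrite ?andbF // (ltnW kl).
Qed.

Lemma uniserial_nilpotent : nilpotent_on U l.
Proof.
move=> m; apply: (co_inj Uco) => k; rewrite co_iter co0.
by case: ltnP; rewrite ?andbF // leqNgt => ->.
Qed.

Lemma uniserial_basis j : exists b, forall k, co b k = ((k == j) && (k < l)%N)%:R.
Proof.
have [b bE] := co_surj Uco (fun k => (k == j)%:R); exists b => k.
by case: (ltnP k l) => kl; rewrite ?andbT ?andbF; [rewrite bE | rewrite (co_ge Uco)].
Qed.

(** If y has nonzero leading coordinate, any m is reduced to 0 by removing its coordinates one after
    the other with multiples of the x^k y. *)
Lemma uniserial_gen_full (W : {vspace U}) y :
  submodule W -> y \in W -> co y 0 != 0 -> W = fullv.
Proof.
move=> sW yW ny; apply/vspaceP => m; rewrite memvf.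
suff H d : forall k m, (l <= k + d)%N -> (forall j, (j < k)%N -> co m j = 0) -> m \in W.
  by apply: (H l 0%N).
elim: d => [|d IHd] {}k {}m lk mk.
  rewrite (_ : m = 0) ?mem0v //; apply: (co_inj Uco) => j; rewrite co0.
  by case: (ltnP j k) => [/mk //|kj]; rewrite (co_ge Uco) //; lia.
(* This scalar cancels coordinate k of m. *)
pose c := - (co m k / co y 0).
have := IHd k.+1 (c *: iter k (step U) y + m).
rewrite rpredDl ?memvZ ?submodule_iter //; apply; first by lia.
move=> j jk; rewrite (co_linear Uco) co_iter.
case: (ltnP j l) => jl; last by rewrite andbF mulr0 add0r (co_ge Uco).
rewrite andbT; case: (ltngtP j k) => [lt|gt|->]; last 1 first.
- by rewrite subnn /c mulNr divfK // addNr.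
- by rewrite mulr0 add0r mk.
- by move: jk; rewrite ltnS leqNgt gt.
Qed.

(** Every nonzero submodule contains the last basis vector: if j is the first nonzero coordinate of
    y in W, then x^(l-1-j) y is a nonzero multiple of it. *)
Lemma uniserial_sub_socle (W : {vspace U}) m : submodule W -> W != 0%VS ->
  (forall k, k != l.-1 -> co m k = 0) -> m \in W.
Proof.
move=> sW nW mk.
have [y yW ny] : exists2 y, y \in W & y != 0.
  by exists (vpick W); rewrite ?memv_pick // vpick0.
have [j [jl nj ymin]] := co_neq0 ny.
rewrite (_ : m = (co m l.-1 / co y j) *: iter (l.-1 - j) (step U) y).
  by rewrite memvZ // submodule_iter.
apply: (co_inj Uco) => k; rewrite coZ co_iter.
case: (eqVneq k l.-1) => [->|nk].
  rewrite leq_subr (_ : (l.-1 < l)%N) /=; last by lia.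
  by rewrite subKn ?divfK //; lia.
rewrite mk //; case: ifP => [/andP [jk kl]|_]; last by rewrite mulr0.
rewrite (ymin (k - (l.-1 - j))%N) ?mulr0 //.
by move: jk kl nk jl; lia.
Qed.

Lemma uniserial_indecomposable : (0 < l)%N -> indecomposable U.
Proof.
move=> l0; have [b bE] := uniserial_basis l.-1.
have nb : b != 0.
  apply/eqP => b0; have := bE l.-1; rewrite b0 co0 eqxx.
  by rewrite (_ : (l.-1 < l)%N) /=; [move/esym/eqP; rewrite oner_eq0 | lia].
have bk k : k != l.-1 -> co b k = 0 by move=> /negPf nk; rewrite bE nk.
split=> [|V W sV sW _ VW].
  by apply: contraNneq nb => f0; rewrite -memv0 -f0 memvf.
case: (eqVneq V 0%VS) => nV; first by left.
case: (eqVneq W 0%VS) => nW; first by right.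
case/negP: nb; rewrite -memv0 -VW memv_cap.
by rewrite (uniserial_sub_socle sV nV bk) (uniserial_sub_socle sW nW bk).
Qed.

(** A homomorphism to Y is determined by the image of b_0, an element of e_p Y killed by x^l. *)
Lemma uniserial_torsion P : P p l -> torsion_of P U.
Proof.
move=> Ppl Y FY f hf.
have [b bE] := uniserial_basis 0.
have fb : f b = 0.
  apply: (FY p l Ppl); rewrite -?hom_idem -?hom_iter //.
    congr (f _); apply: (co_inj Uco) => k; rewrite (co_idem Uco) bE.
    by case: k => [|k] //=; rewrite ?eqxx // if_same.
  by rewrite uniserial_nilpotent linear0.
apply/lfunP => m; rewrite zero_lfunE.
case: (posnP l) => [l0|l0].
  by rewrite (_ : m = 0) ?linear0 //; have := uniserial_nilpotent m; rewrite l0.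
suff kf : lker f = fullv by apply/eqP; rewrite -memv_ker kf memvf.
apply: (@uniserial_gen_full _ b); rewrite ?memv_ker ?fb ?bE ?l0 ?oner_eq0 //.
by move=> a w; rewrite !memv_ker hf => /eqP ->; rewrite linear0.
Qed.

(** If y in e_q U is killed by x^k and has a nonzero coordinate j, then q = p + j and l - j <= k, so
    P(q,k) would give the excluded P(p+j,l-j). *)
Lemma uniserial_torsionfree P : extension_closed P ->
  (forall j, (j < l)%N -> ~ P (iter j (@ordS n) p) (l - j)%N) -> torsionfree_of P U.
Proof.
move=> clP nP q k Pqk y yq yk; apply/eqP; apply: contraT => ny.
have [j [jl nj _]] := co_neq0 ny; case: (nP j jl).
have -> : iter j (@ordS n) p = q.
  apply/eqP; apply: contraR nj => /negPf npq.
  by rewrite -yq (co_idem Uco) npq.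
apply: closed_le Pqk => //; rewrite leq_subLR leqNgt; apply: contra nj => jkl.
have := congr1 (co ^~ (j + k)%N) yk; rewrite co_iter co0 leq_addl jkl addnK => /= ->.
by rewrite eqxx.
Qed.

Lemma uniserial_length_ge k : nilpotent_on U k -> (l <= k)%N.
Proof.
move=> nk; rewrite leqNgt; apply/negP => kl.
have [b bE] := uniserial_basis 0.
have := congr1 (co ^~ k) (nk b); rewrite co_iter co0 leqnn kl subnn bE /=.
by rewrite (leq_ltn_trans _ kl) // => /eqP; rewrite oner_eq0.
Qed.

End UniserialTheory.

Lemma uniserial_iso_length (n : nat) (K : fieldType) (p q : 'I_n) l k
    (U V : nilmod (cyclic_quiver n) K) (cU : U -> nat -> K) (cV : V -> nat -> K) :
  is_uniserial p l cU -> is_uniserial q k cV -> isomorphic U V -> (k <= l)%N.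
Proof.
move=> uU uV [f hf [g fK gK]]; apply: (uniserial_length_ge uV) => m.
by rewrite -(gK m) -hom_iter // (uniserial_nilpotent uU) linear0.
Qed.

(** * Simple tops and simple socles *)

Section SimpleModule.
Local Open Scope ring_scope.
Variables (n : nat) (K : fieldType) (v : 'I_n).
Local Notation Q := (cyclic_quiver n).
Local Notation S := (@simple_at Q K v).

Lemma simple_actU (p : qpath Q) (c : S) :
  act S (pathU K p) c = (p == @trivial_path Q v)%:R * (c : K^o).
Proof.
have -> : act S (pathU K p) c = (pathU K p)@_(@trivial_path Q v) *: c.
  by rewrite [LHS]scale_lfunE id_lfunE.
by congr (_ * _); exact: mcoeffU.
Qed.

Lemma simple_idem i (c : S) : idem S i c = if i == v then c else 0.
Proof.
rewrite idem.unlock simple_actU.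
have -> : (@trivial_path Q i == @trivial_path Q v) = (i == v).
  by apply/eqP/eqP => [/(congr1 (@pstart Q))|->].
by case: (i == v); rewrite ?mul1r ?mul0r.
Qed.

Lemma simple_step (c : S) : step S c = 0.
Proof.
rewrite step_sum big1 // => a _; rewrite arr.unlock simple_actU.
have -> : (@arrow_path Q a == @trivial_path Q v) = false.
  by apply/eqP => /(congr1 (@psteps Q)).
by rewrite mul0r.
Qed.

End SimpleModule.

Section TopSocle.
Local Open Scope ring_scope.
Variables (n : nat) (K : fieldType).
Local Notation Q := (cyclic_quiver n).
Local Notation nmod := (nilmod Q K).
Local Notation S := (@simple_at Q K).

(** By [uniserial_gen_full] every proper submodule lies in the kernel of the leading coordinate,
    which is thus the only maximal submodule. *)
Lemma uniserial_top p l (U : nmod) (co : U -> nat -> K) :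
  is_uniserial p l co -> (0 < l)%N -> has_top U (S p).
Proof.
move=> Uco l0; have [b bE] := uniserial_basis Uco 0.
have [|f fE] := @linear_lfun K U (K^o) (fun m => co m 0%N).
  by move=> c m m'; exact: (co_linear Uco).
have hf : is_hom (f : 'Hom(U, S p)).
  apply: is_homP => [i m|m].
    by rewrite simple_idem !fE (co_idem Uco) eq_sym.
  by rewrite simple_step fE (co_step Uco).
have fb : f b = 1 by rewrite fE bE l0.
have kerP m : (m \in lker f) = (co m 0%N == 0) by rewrite memv_ker fE.
have sk : submodule (lker f).
  by move=> a m; rewrite !memv_ker => /eqP m0; rewrite (hf a) m0 linear0.
have nk : lker f != fullv.
  by apply/eqP => E; have := memvf b; rewrite -E memv_ker fb oner_eq0.
have full (W : {vspace U}) : submodule W -> W != fullv -> (W <= lker f)%VS.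
  move=> sW /eqP nW; apply/subvP => y yW; rewrite kerP.
  by apply: contraT => ny; case: nW; exact: (uniserial_gen_full Uco sW yW ny).
exists f; split=> //.
  apply/vspaceP => c; rewrite memvf; apply/memv_imgP; exists (c *: b); rewrite ?memvf //.
  by rewrite linearZ /= fb; symmetry; exact: mulr1.
move=> m; split=> [km W [sW nW maxW]|rad]; last first.
  apply: rad; split=> // V sV kV; case: (eqVneq V fullv) => nV; [by right|left].
  by apply/eqP; rewrite eqEsubv kV full.
by have [<- //|E] := maxW _ sk (full W sW nW); rewrite E eqxx in nk.
Qed.

(** The last basis vector lies in every nonzero submodule, so its line is the only simple one; the
    length being l + 1, it sits l steps after p. *)
Lemma uniserial_socle p l (U : nmod) (co : U -> nat -> K) :
  is_uniserial p l.+1 co -> has_socle U (S (iter l (@ordS n) p)).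
Proof.
move=> Uco; have [b bE] := uniserial_basis Uco l.
have bk k : k != l -> co b k = 0 by move=> /negPf nk; rewrite bE nk.
have nb : b != 0.
  apply/eqP => b0; have := bE l; rewrite b0 (co0 Uco) eqxx ltnSn /=.
  by move/esym/eqP; rewrite oner_eq0.
have [|f fE] := @linear_lfun K (K^o) U (fun c => (c : K) *: b).
  by move=> c m m'; rewrite scalerDl scalerA.
have ib i : idem U i b = if i == iter l (@ordS n) p then b else 0.
  apply: (co_inj Uco) => k; rewrite (co_idem Uco).
  case: (eqVneq k l) => [->|nk].
    by rewrite eq_sym; case: ifP; rewrite ?(co0 Uco).
  by rewrite bk // if_same; case: ifP; rewrite ?(co0 Uco) ?bk.
have xb : step U b = 0.
  apply: (co_inj Uco) => k; rewrite (co_step Uco) (co0 Uco).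
  case: k => // k; case: ltnP => // kl; rewrite bk //.
  by apply/eqP => kl'; move: kl; rewrite kl' ltnn.
have imE m : m \in limg f <-> m \in <[b]>%VS.
  split=> [/memv_imgP [c _ ->]|/vlineP [c ->]]; first by rewrite fE memvZ ?memv_line.
  by rewrite -fE memv_img ?memvf.
exists f; split.
- apply: is_homP => [i c|c]; rewrite ?simple_idem ?simple_step !fE linearZ /=.
    by rewrite ib; case: ifP; rewrite ?scale0r ?scaler0.
  by rewrite xb scaler0 scale0r.
- apply/eqP/lker0P => c d; rewrite !fE => /eqP; rewrite -subr_eq0 -scalerBl.
  by rewrite scaler_eq0 (negPf nb) orbF subr_eq0 => /eqP.
have sb : submodule (<[b]>%VS : {vspace U}).
  apply: act_stable => [i _ /vlineP [c ->]|_ /vlineP [c ->]]; rewrite linearZ /=.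
    by rewrite ib memvZ //; case: ifP; rewrite ?mem0v ?memv_line.
  by rewrite xb scaler0 mem0v.
have bW (W : {vspace U}) : submodule W -> W != 0%VS -> (<[b]> <= W)%VS.
  by move=> sW nW; rewrite -memvE; exact: (uniserial_sub_socle Uco sW nW).
have nb0 : <[b]>%VS != 0%VS :> {vspace U} by rewrite -dimv_eq0 dim_vline nb.
move=> m; rewrite imE; split=> [mb W WS|soc].
  have /subvP sub : (<[b]> <= W)%VS; last exact: sub.
  apply: WS; split=> // V sV Vb.
  case: (eqVneq V 0%VS) => nV; [by left | right].
  by apply/eqP; rewrite eqEsubv Vb bW.
apply: soc => V [sV nV minV].
have [E|-> //] := minV _ sb (bW V sV nV); first by rewrite E eqxx in nb0.
Qed.

(** A description of M as U(p,L) without a basis: z generates M, and the Loewy length L is attained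
    on z. *)
Definition uniserial_gen (M : nmod) (p : 'I_n) (L : nat) (z : M) : Prop :=
  [/\ (0 < L)%N, nilpotent_on M L, idem M p z = z, iter L.-1 (step M) z != 0 &
      forall W : {vspace M}, submodule W -> z \in W -> W = fullv].

Lemma limg_submodule (M N : nmod) (f : 'Hom(M, N)) : is_hom f -> submodule (limg f).
Proof.
by move=> hf a _ /memv_imgP [m _ ->]; rewrite -hf memv_img ?memvf.
Qed.

(** [loewy_hom] gives surjections both ways, and equal dimensions make one of them an
    isomorphism. *)
Lemma uniserial_gen_iso (M N : nmod) p L (z : M) (y : N) :
  uniserial_gen p L z -> uniserial_gen p L y -> isomorphic M N.
Proof.
have surj (M' N' : nmod) (z' : M') (y' : N') :
    uniserial_gen p L z' -> uniserial_gen p L y' ->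
    exists2 f : 'Hom(M', N'), is_hom f & limg f = fullv.
  case=> L0 nM zp nz _ [_ nN yp _ geny].
  have [f hf fz] := loewy_hom nM L0 zp nz yp (nN y').
  exists f => //; have sf := limg_submodule hf; apply: geny => //.
  by apply: fz; rewrite ?memv_img ?memvf.
move=> gz gy; have [f hf imf] := surj _ _ _ _ gz gy.
have [g _ img] := surj _ _ _ _ gy gz.
apply: (hom_iso hf) => //; apply/eqP; rewrite -dimv_eq0.
have := limg_ker_dim f fullv; rewrite imf capfv.
have := limg_ker_dim g fullv; rewrite img.
by move=> *; lia.
Qed.

Lemma proper_sub_maximal (M : nmod) (W : {vspace M}) :
  submodule W -> W != fullv -> exists2 V, maximal_submodule V & (W <= V)%VS.
Proof.
suff H k : forall W : {vspace M}, submodule W -> W != fullv ->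
    (\dim {:M} - \dim W <= k)%N -> exists2 V, maximal_submodule V & (W <= V)%VS.
  by move=> sW nW; exact: (H _ W sW nW (leqnn _)).
elim: k => [|k IHk] {}W sW nW dW.
  case/eqP: nW; apply/eqP; rewrite eqEdim subvf /=; lia.
case: (classic (maximal_submodule W)) => [mW|nmax]; first by exists W.
have [V [sV WV VW Vf]] : exists V : {vspace M},
    [/\ submodule V, (W <= V)%VS, V != W & V != fullv].
  apply: NNPP => no; apply: nmax; split=> // V sV WV.
  case: (eqVneq V W) => VW; [by left | right].
  by apply/eqP; apply: contraT => Vf; case: no; exists V.
have [|X mX VX] := IHk V sV Vf; last by exists X => //; exact: subv_trans VX.
have := dimv_leqif_eq WV => /leqifP; rewrite eq_sym (negPf VW).
have := dimvS (subvf V); lia.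
Qed.

(** Let z in e_v M lift 1 from the top. A maximal submodule containing z would contain rad M + K z,
    which is M; so z generates M. If x^(L-1) z were 0, the submodule ker x^(L-1) would contain z and
    be M, against the minimality of L. *)
Lemma top_gen (M : nmod) v : has_top M (S v) -> exists L (z : M), uniserial_gen v L z.
Proof.
case=> f [hf imf radE].
have [z0 fz0] : exists z0, f z0 = (1 : K^o).
  have : (1 : K^o) \in limg f by rewrite imf memvf.
  by case/memv_imgP => z0 _ ->; exists z0.
pose z := idem M v z0.
have zv : idem M v z = z by rewrite /z idem_idem eqxx.
have fz : f z = (1 : K^o) by rewrite /z hom_idem // simple_idem eqxx.
have gen (W : {vspace M}) : submodule W -> z \in W -> W = fullv.
  move=> sW zW; apply/eqP; apply: contraT => nW.
  have [V mV /subvP WV] := proper_sub_maximal sW nW.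
  have [_ /eqP nV _] := mV; case: nV; apply/vspaceP => m; rewrite memvf.
  have E : f m = f ((f m : K^o) *: z).
    by rewrite linearZ /= fz; symmetry; exact: mulr1.
  rewrite -[m](subrK ((f m : K^o) *: z)) rpredD //; last by rewrite memvZ ?WV.
  apply: (proj1 (radE _) _ V mV); rewrite memv_ker linearB /= -E; apply/eqP; exact: subrr.
have [L nL minL] := loewy_length (nilmodP M).
have L0 : (0 < L)%N.
  rewrite lt0n; apply/eqP => L0; have := nL z; rewrite L0 /= => z0'.
  by have := oner_neq0 K; rewrite -[1]fz z0' linear0 eqxx.
exists L, z; split=> //; apply/negP => /eqP xz.
suff : nilpotent_on M L.-1 by move/minL; lia.
have [|g gE] := @linear_lfun K M M (fun m => iter L.-1 (step M) m).
  by move=> c m m'; rewrite iter_stepD iter_stepZ.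
have sk : submodule (lker g).
  apply: act_stable => [i m|m]; rewrite !memv_ker !gE => /eqP m0.
    by rewrite iter_step_idem m0 linear0.
  by rewrite -iterSr iterS m0 linear0.
have kf := gen _ sk; rewrite memv_ker gE xz eqxx in kf.
by move=> m; apply/eqP; rewrite -gE -memv_ker kf ?memvf.
Qed.

(** An e_i m with x m = 0 spans a simple submodule or is 0, so ker x is the line of s. For z of
    maximal length, x^(L-1) z spans this line. *)
Lemma socle_gen (M : nmod) v : has_socle M (S v) -> exists p L (z : M),
  uniserial_gen p L z /\ iter L.-1 (@ordS n) p = v.
Proof.
case=> f [hf kf socE]; pose s : M := f (1 : K^o).
have sv : idem M v s = s by rewrite /s -hom_idem // simple_idem eqxx.
have ns : s != 0.
  apply/eqP => s0; move/eqP/lker0P: kf => /(_ 1 0); rewrite -/s s0 linear0.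
  by move/(_ erefl)/eqP; rewrite oner_eq0.
have ker_s m : step M m = 0 -> exists c, m = c *: s.
  move=> xm; have : m \in limg f.
    apply/socE => W WS; rewrite -[m]sum_idem; apply: memv_suml => i _.
    have xi : step M (idem M i m) = 0 by rewrite step_idem xm linear0.
    case: (eqVneq (idem M i m) 0) => [->|ni]; first exact: mem0v.
    rewrite memvE; apply: WS; split=> [| |V sV Vi].
    - apply: act_stable => [j _ /vlineP [c ->]|_ /vlineP [c ->]]; rewrite linearZ /=.
        by rewrite idem_idem memvZ //; case: ifP => _; rewrite ?mem0v ?memv_line.
      by rewrite xi scaler0 mem0v.
    - by rewrite -dimv_eq0 dim_vline ni.
    - case: (eqVneq V 0%VS) => nV; [by left | right].
      apply/eqP; rewrite eqEdim Vi dim_vline ni lt0n dimv_eq0; exact: nV.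
  case/memv_imgP => c _ ->; exists (c : K); rewrite /s -linearZ /=.
  by congr (f _); symmetry; exact: mulr1.
have [L nL minL] := loewy_length (nilmodP M).
have [|p [z [L0 zp nz]]] := loewy_witness nL minL; first by exists s.
have [|c0 cE] := ker_s (iter L.-1 (step M) z).
  by rewrite -iterS prednK // nL.
have nc0 : c0 != 0 by apply: contraNneq nz => c00; rewrite cE c00 scale0r.
exists p, L, z; split; last first.
  have : idem M v (iter L.-1 (step M) z) = iter L.-1 (step M) z.
    by rewrite cE linearZ /= sv.
  rewrite (iter_fixed_idem _ _ zp); case: eqP => // _ z0.
  by rewrite -z0 eqxx in nz.
split=> // W sW zW; apply/vspaceP => m; rewrite memvf.
(* By induction ker x^j lies in W: a multiple of x^(L-1-j) z corrects an element of ker x^(j+1) to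
   one of ker x^j. *)
suff H j : (j <= L)%N -> forall m, iter j (step M) m = 0 -> m \in W by exact: (H L).
elim: j => [_|j IHj jL] {}m xm; first by move: xm => /= ->; exact: mem0v.
have [c cE'] := ker_s (iter j (step M) m) xm.
pose w := (c / c0) *: iter (L.-1 - j) (step M) z.
rewrite -[m](subrK w) rpredD //; last by rewrite memvZ ?submodule_iter.
apply: IHj; first exact: ltnW.
have xw : iter j (step M) w = c *: s.
  by rewrite iter_stepZ -iterD subnKC; [rewrite cE scalerA divfK | lia].
by rewrite -scaleN1r iter_stepD iter_stepZ cE' xw scaleN1r subrr.
Qed.

Lemma inj_unbounded (f : nat -> nat) : injective f -> forall l, exists k, (l <= f k)%N.
Proof.
move=> injf l; apply: NNPP => no.
have lt k : (f k < l)%N by rewrite ltnNge; apply/negP => h; apply: no; exists k.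
have := @leq_card 'I_l.+1 'I_l (fun k => Ordinal (lt k)).
rewrite !card_ord ltnn => /(_ _)/notF; apply=> i j [] /injf; exact: val_inj.
Qed.

End TopSocle.

(** * Depth functions and the ancestor relation *)

Section DepthFunctions.
Variable n : nat.
Hypothesis n_gt0 : 0 < n.
Local Notation fwd j p := (iter j (@ordS n) p).
Local Notation bwd j p := (iter j (@ord_pred n) p).
Implicit Types (p q : 'I_n) (r : 'I_n -> nat) (P : 'I_n -> nat -> Prop).

Lemma fwdK j : cancel (iter j (@ordS n)) (iter j (@ord_pred n)).
Proof. by elim: j => // j IHj p; rewrite iterSr iterS ordSK IHj. Qed.

Lemma bwdK j : cancel (iter j (@ord_pred n)) (iter j (@ordS n)).
Proof. by elim: j => // j IHj p; rewrite iterSr iterS ord_predK IHj. Qed.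

Lemma fwd_bwd j d p : j <= d -> fwd j (bwd d p) = bwd (d - j) p.
Proof. by move=> jd; rewrite -[in LHS](subnKC jd) iterD bwdK. Qed.

Lemma val_fwd j p : val (fwd j p) = (p + j) %% n.
Proof.
elim: j => [|j IHj] /=; first by rewrite addn0 modn_small.
by rewrite IHj -addn1 modnDml -addnA addn1.
Qed.

Lemma fwd_n p : fwd n p = p.
Proof. by apply: val_inj; rewrite val_fwd modnDr modn_small. Qed.

Lemma fwd_reach p q : exists2 j, j < n & fwd j p = q.
Proof.
exists ((q + (n - p)) %% n); first by rewrite ltn_mod.
apply: val_inj; rewrite val_fwd modnDmr addnCA subnKC ?modnDr ?modn_small //.
exact: ltnW.
Qed.

Lemma fwd_reach_pos p q : exists2 j, 0 < j <= n & fwd j p = q.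
Proof.
have [j jn <-] := fwd_reach (ordS p) q; exists j.+1 => //.
by rewrite iterSr.
Qed.

Lemma bwd_reach_pos p q : exists2 d, 0 < d & bwd d p = q.
Proof.
by have [j /andP [j0 _] <-] := fwd_reach_pos q p; exists j => //; rewrite fwdK.
Qed.

Definition depth_fun r : Prop :=
  (forall p, r (ordS p) <= (r p).+1) /\ exists p, r p = 0.

Definition fin_datum r : 'I_n -> nat -> Prop :=
  fun p l => forall j, 0 < j <= l -> r p < r (fwd j p).

(** The zeros of r become tops of full rays; the other vertices keep the intervals of
    [fin_datum]. *)
Definition inf_datum r : 'I_n -> nat -> Prop :=
  fun p l => r p = 0 \/ fin_datum r p l.

Definition unbounded P p : Prop := forall l, P p l.

Lemma fin_datum_closed r : extension_closed (fin_datum r).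
Proof.
split=> [p j|p k l kl Pl j /andP [j0 jk]|p k l Pk Pl j /andP [j0 jkl]].
- by case/andP => j0; rewrite leqNgt j0.
- by apply: Pl; rewrite j0 (leq_trans jk).
- case: (leqP j k) => jk; first by apply: Pk; rewrite j0.
  have := Pl (j - k); rewrite -iterD subnK ?(ltnW jk) // subn_gt0 jk leq_subLR jkl.
  move/(_ isT); apply: leq_ltn_trans; case: (posnP k) => [-> //|k0].
  by apply: ltnW; apply: Pk; rewrite k0 leqnn.
Qed.

Lemma inf_datum_closed r : extension_closed (inf_datum r).
Proof.
have cl := fin_datum_closed r.
split=> [p|p k l kl [r0|Pl]|p k l [r0|Pk]]; try by left.
- by right; exact: closed0 cl p.
- by right; exact: closed_le cl _ _ _ kl Pl.
case=> [rk|Pl]; last by right; exact: closedD cl _ _ _ Pk Pl.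
case: (posnP k) => [k0|k0]; first by left; move: rk; rewrite k0.
by have := Pk k; rewrite k0 leqnn rk ltn0 => /(_ isT).
Qed.

Lemma fin_datum_bounded r p : ~ fin_datum r p n.
Proof. by move/(_ n); rewrite n_gt0 leqnn fwd_n ltnn => /(_ isT). Qed.

Section Parent.
Variable r : 'I_n -> nat.
Hypothesis rP : depth_fun r.

(** The parent q is the nearest vertex behind p with smaller value. The vertex after q has value at
    least r(p), and r rises by at most one per step, so r(q) = r(p) - 1. *)
Lemma depth_parent p : 0 < r p -> exists d q,
  [/\ 0 < d, fwd d q = p, fin_datum r q d & r p = (r q).+1].
Proof.
case: rP => rS [z rz] rp.
have exd : exists d, (0 < d) && (r (bwd d p) < r p).
  by have [d d0 dz] := bwd_reach_pos p z; exists d; rewrite d0 dz rz.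
case: (ex_minnP exd) => d /andP [d0 rd] min.
have ge k : k < d -> r p <= r (bwd k p).
  case: (posnP k) => [-> //|k0] kd; rewrite leqNgt; apply/negP => rk.
  by have := min k; rewrite k0 rk leqNgt kd => /(_ isT).
exists d, (bwd d p); split=> //; first exact: bwdK.
  move=> j /andP [j0 jd]; apply: leq_trans rd _; rewrite fwd_bwd //.
  by apply: ge; rewrite -{2}(subn0 d) ltn_sub2l.
apply/eqP; rewrite eqn_leq rd andbT.
apply: leq_trans (rS (bwd d p)); rewrite -[ordS _]/(fwd 1 _) fwd_bwd //.
by apply: ge; rewrite subn1 ltn_predL.
Qed.

End Parent.

(** Induction on r(p). If r(p) < r'(p), the parent q of p for r' satisfies r(q) < r(p) and, by
    induction, r(q) = r'(q) = r'(p) - 1 >= r(p), a contradiction. The other case is symmetric. *)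
Lemma fin_datum_inj r r' : depth_fun r -> depth_fun r' ->
  (forall p l, fin_datum r p l <-> fin_datum r' p l) -> r =1 r'.
Proof.
move=> rP rP' E; suff H m p : r p < m -> r p = r' p by move=> p; exact: H (ltnSn _).
elim: m p => // m IHm p; rewrite ltnS => rm.
have last d q (s : 'I_n -> nat) : 0 < d -> fwd d q = p -> fin_datum s q d -> s q < s p.
  by move=> d0 <-; apply; rewrite d0 leqnn.
case: (ltngtP (r p) (r' p)) => // lt.
  have [d [q [d0 dq Pq rq]]] := depth_parent rP' (leq_ltn_trans (leq0n _) lt).
  have rqp : r q < r p by apply: last d0 dq _; apply/E.
  have := IHm q (leq_trans rqp rm) => e.
  by move: lt; rewrite rq -e ltnS leqNgt rqp.
have [d [q [d0 dq Pq rq]]] := depth_parent rP (leq_ltn_trans (leq0n _) lt).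
have rqp : r' q < r' p by apply: last d0 dq _; apply/E.
have e : r q = r' q by apply: IHm; rewrite -ltnS -rq.
by move: lt; rewrite rq e ltnS leqNgt rqp.
Qed.

Lemma inf_datum_unbounded r p : unbounded (inf_datum r) p <-> r p = 0.
Proof.
split=> [H|r0 l]; last by left.
by case: (H n) => // /fin_datum_bounded.
Qed.

(** The finite datum is recovered from the infinite one as the (p,l) for which p+1, ..., p+l avoid
    the tops of full rays. *)
Lemma inf_datum_inj r r' : depth_fun r -> depth_fun r' ->
  (forall p l, inf_datum r p l <-> inf_datum r' p l) -> r =1 r'.
Proof.
move=> rP rP' E; apply: fin_datum_inj => // p l.
have finE s : fin_datum s p l <->
    inf_datum s p l /\ forall j, 0 < j <= l -> ~ unbounded (inf_datum s) (fwd j p).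
  split=> [H|[[s0|//] H] j jl].
    split=> [|j /H lt /inf_datum_unbounded e]; first by right.
    by move: lt; rewrite e.
  by rewrite s0 lt0n; apply/eqP => /inf_datum_unbounded; exact: H.
rewrite !finE; split=> -[H1 H2]; (split=> [|j /H2 nu u]; first exact/E);
  by apply: nu => k; apply/E; exact: u.
Qed.

(** A single return to p can be repeated by extension, giving multiples of d. *)
Lemma closed_unbounded P p d : extension_closed P -> 0 < d ->
  fwd d p = p -> P p d -> unbounded P p.
Proof.
move=> cl d0 dp Pd l; have H k : P p (k * d).
  elim: k => [|k IHk]; first exact: closed0.
  by rewrite mulSn; apply: (closedD cl) => //; rewrite dp.
by apply: (closed_le cl) (H l); rewrite leq_pmulr.
Qed.

Section Ancestors.
Variable P : 'I_n -> nat -> Prop.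
Hypothesis clP : extension_closed P.
Hypothesis bdP : forall p, ~ unbounded P p.

Definition ancestors p : {set 'I_n} :=
  [set q | asbool (exists d, [/\ 0 < d, fwd d q = p & P q d])].

Lemma ancestorsP q p :
  reflect (exists d, [/\ 0 < d, fwd d q = p & P q d]) (q \in ancestors p).
Proof. by rewrite inE; exact: asboolP. Qed.

Definition depth p := #|ancestors p|.

(** Extension makes the relation transitive, and a vertex that is its own ancestor would carry a
    full ray. *)
Lemma ancestors_proper q p : q \in ancestors p -> ancestors q \proper ancestors p.
Proof.
move=> qp; apply/properP; split; last first.
  exists q => //; apply/negP => /ancestorsP [d [d0 dq Pd]].
  exact: bdP (closed_unbounded clP d0 dq Pd).
case/ancestorsP: qp => d [d0 dq Pd].
apply/subsetP => a /ancestorsP [k [k0 ka Pk]]; apply/ancestorsP; exists (k + d).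
split; first by rewrite addn_gt0 k0.
  by rewrite addnC iterD ka.
by apply: (closedD clP) => //; rewrite ka.
Qed.

(** For the converse, take the least j with P(p,j) false. An ancestor of p+j from beyond p is an
    ancestor of p by shortening, while one at p or between p and p+j would give P(p,j) by extension.
    So depth(p+j) <= depth(p), which excludes j <= l. *)
Lemma depthP p l : P p l <-> fin_datum depth p l.
Proof.
split=> [Pl j /andP [j0 jl]|].
  apply/proper_card/ancestors_proper/ancestorsP; exists j; split=> //.
  exact: (closed_le clP) Pl.
move=> H; apply: NNPP => nPl.
have exj : exists j, ~~ asbool (P p j) by exists l; apply/asboolP.
case: (ex_minnP exj) => j /asboolP nPj min.
have jl : j <= l by apply: min; apply/asboolP.
have Pk k : k < j -> P p k.
  by move=> kj; apply/asboolP; apply: contraTT kj => /min; rewrite leqNgt.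
have j0 : 0 < j by case: (posnP j) => // e; case: nPj; rewrite e; exact: closed0.
have : depth p < depth (fwd j p) by apply: H; rewrite j0.
rewrite ltnNge => /negP; apply; apply: subset_leq_card; apply/subsetP => a.
case/ancestorsP => d [d0 dE Pd]; apply/ancestorsP.
case: (ltngtP j d) => jd.
- exists (d - j); split; first by rewrite subn_gt0.
    by apply: (@iter_ordS_inj n j); rewrite -iterD subnKC // ltnW.
  by apply: (closed_le clP) Pd; exact: leq_subr.
- case: nPj; rewrite -(subnK (ltnW jd)).
  have ea : a = fwd (j - d) p.
    by apply: (@iter_ordS_inj n d); rewrite dE -iterD subnKC // ltnW.
  by apply: (closedD clP); [apply: Pk; rewrite ltn_subrL d0 j0 | rewrite -ea].
- case: nPj; rewrite jd; have <- // : a = p.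
  by apply: (@iter_ordS_inj n d); rewrite dE jd.
Qed.

(** By shortening, an ancestor of p+1 is p or an ancestor of p. A vertex of least depth has no
    ancestor. *)
Lemma depth_depth_fun : depth_fun depth.
Proof.
split=> [p|].
  suff /subset_leq_card le : ancestors (ordS p) \subset p |: ancestors p.
    by apply: leq_trans le _; rewrite cardsU1 -add1n leq_add2r leq_b1.
  apply/subsetP => a /ancestorsP [d [d0 dE Pd]].
  case: d d0 dE Pd => // d _ dE Pd.
  have {}dE : fwd d a = p by apply: (@ordS_inj n); rewrite -dE.
  rewrite !inE -dE; case: (posnP d) => [-> //|d0]; first by rewrite eqxx.
  apply/orP; right; apply/asboolP; exists d; split=> //.
  by apply: (closed_le clP) Pd.
pose p0 := Ordinal n_gt0.
case: (arg_minnP depth (erefl : xpredT p0)) => p _ min; exists p.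
case: (posnP (depth p)) => // /card_gt0P [q /ancestors_proper /proper_card].
by rewrite ltnNge (min q).
Qed.

End Ancestors.

Lemma fin_datum_surj P : extension_closed P -> (forall p, ~ unbounded P p) ->
  exists2 r, depth_fun r & forall p l, P p l <-> fin_datum r p l.
Proof.
move=> clP bdP; exists (depth P); first exact: depth_depth_fun.
by move=> p l; exact: depthP.
Qed.

Lemma inf_datum_surj P : extension_closed P -> (exists p, unbounded P p) ->
  exists2 r, depth_fun r & forall p l, P p l <-> inf_datum r p l.
Proof.
move=> clP [v uv].
(* [P'] drops the intervals p+1, ..., p+l that meet the top of a full ray, so that these tops become
   roots. It has no full ray, since n steps reach every vertex. *)
pose P' p l := P p l /\ forall j, 0 < j <= l -> ~ unbounded P (fwd j p).
have [||r rP rE] := @fin_datum_surj P'.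
- split=> [p|p k l kl [Pl H]|p k l [Pk Hk] [Pl Hl]].
  + by split=> [|[|j]] //; exact: closed0.
  + split=> [|j /andP [j0 jk]]; first exact: (closed_le clP) Pl.
    by apply: H; rewrite j0 (leq_trans jk).
  + split=> [|j /andP [j0 jkl]]; first exact: closedD.
    case: (leqP j k) => jk; first by apply: Hk; rewrite j0.
    have := Hl (j - k); rewrite -iterD subnK ?(ltnW jk) //; apply.
    by rewrite subn_gt0 jk leq_subLR.
- move=> p /(_ n) [_ H]; have [j jn jv] := fwd_reach_pos p v.
  by apply: (H j jn); rewrite jv.
(* The zeros of r are exactly the tops of full rays: any other vertex has the nearest such top
   behind it as an ancestor. *)
have uE q : unbounded P q <-> r q = 0.
  split=> [uq|rq].
    case: (posnP (r q)) => // /(depth_parent rP) [d [a [d0 da Pa _]]].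
    have [_ /(_ d)] := proj2 (rE _ _) Pa.
    by rewrite d0 leqnn da => /(_ isT).
  apply: NNPP => nu.
  have exd : exists d, (0 < d) && asbool (unbounded P (bwd d q)).
    have [d d0 dv] := bwd_reach_pos q v; exists d; rewrite d0 dv.
    exact/asboolP.
  case: (ex_minnP exd) => d /andP [d0 /asboolP ud] min.
  have : P' (bwd d q) d.
    split=> [|j /andP [j0 jd]]; first exact: ud.
    rewrite fwd_bwd //; case: (posnP (d - j)) => [-> //|dj] uj.
    have := min (d - j); rewrite dj leqNgt ltn_subrL j0 d0 => H.
    by apply/notF/H/asboolP.
  by move/rE/(_ d); rewrite d0 leqnn bwdK rq ltn0 => /(_ isT).
exists r => // p l; split=> [Pl|[/uE //|/rE []//]].
case: (classic (unbounded P p)) => [/uE|nu]; [by left | right].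
(* A full ray at p+j with j <= l would extend P(p,j) to a full ray at p. *)
apply/rE; split=> // j /andP [j0 jl] uj; apply: nu => k.
apply: (closed_le clP) (_ : P p (j + k)); first exact: leq_addl.
by apply: (closedD clP) (uj k); exact: (closed_le clP) Pl.
Qed.

End DepthFunctions.

(** * Full rays as the sets L_T and R_F *)

Section RaysAndCorays.
Local Open Scope ring_scope.
Variables (n : nat) (K : fieldType).
Hypothesis n_gt0 : (0 < n)%N.
Local Notation Q := (cyclic_quiver n).
Local Notation nmod := (nilmod Q K).
Variable P : 'I_n -> nat -> Prop.
Hypothesis clP : extension_closed P.

(** If P(p,l) fails, let k <= l be least with P(p,k) false. Then U(p,k) is torsion-free, since
    P(p+j,k-j) and P(p,j) would give P(p,k), and its generator is a nonzero element killed by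
    x^l. *)
Lemma datum_torsionfree_of p l : datum (@torsionfree_of n K P) p l <-> P p l.
Proof.
split=> [H|Ppl Y FY y yp yl]; last exact: FY Ppl y yp yl.
apply: NNPP => nPl.
have exj : exists j, ~~ asbool (P p j) by exists l; apply/asboolP.
case: (ex_minnP exj) => k /asboolP nPk min.
have kl : (k <= l)%N by apply: min; apply/asboolP.
have Pj j : (j < k)%N -> P p j.
  by move=> jk; apply/asboolP; apply: contraTT jk => /min; rewrite leqNgt.
have k0 : (0 < k)%N by case: (posnP k) => // e; case: nPk; rewrite e; exact: closed0.
have [U [co Uco]] := uniserial_exists K p k.
have FU : torsionfree_of P U.
  apply: (uniserial_torsionfree Uco clP) => j jk Pjk; apply: nPk.
  by rewrite -(subnKC (ltnW jk)); apply: (closedD clP) => //; exact: Pj.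
have [b bE] := uniserial_basis Uco 0.
have b0 : b = 0.
  apply: (H U FU).
    apply: (co_inj Uco) => i; rewrite (co_idem Uco) bE.
    by case: i => [|i] /=; rewrite ?eqxx // if_same.
  exact: (iter_step_ge kl (uniserial_nilpotent Uco b)).
by have := bE 0%N; rewrite b0 (co0 Uco) k0 /= => /esym/eqP; rewrite oner_eq0.
Qed.

Lemma torsion_gen (M : nmod) p L (z : M) :
  torsion_of P M -> uniserial_gen p L z -> P p L.
Proof.
move=> TM [L0 nL zp nz _]; apply/datum_torsionfree_of => Y FY y yp yL.
have [f hf fz] := loewy_hom nL L0 zp nz yp yL.
apply/eqP; rewrite -memv0; apply: fz.
  by move=> a m; rewrite memv0 => /eqP ->; rewrite linear0 mem0v.
by rewrite (TM Y FY f hf) zero_lfunE mem0v.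
Qed.

Lemma uniserial_choice (p : nat -> 'I_n) (l : nat -> nat) :
  exists (U : nat -> nmod) (co : forall k, U k -> nat -> K),
    forall k, is_uniserial (p k) (l k) (co k).
Proof.
pose T := {U : nmod & U -> nat -> K}.
have exU k : exists x : T, is_uniserial (p k) (l k) (projT2 x).
  by have [U [co Uco]] := uniserial_exists K (p k) (l k); exists (existT _ U co).
pose x k := constructive_indefinite_description _ (exU k).
exists (fun k => projT1 (sval (x k))), (fun k => projT2 (sval (x k))) => k.
exact: svalP (x k).
Qed.

(** Modules with top S_v are determined by their length, so infinitely many of them have unbounded
    lengths. Conversely a full ray supplies the U(v,k+1). *)
Lemma Lset_torsion_of v : Lset (@torsion_of n K P) v <-> unbounded P v.
Proof.
split=> [[M [MP noniso]]|uv].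
  have gen k : exists x : {L : nat & M k}, uniserial_gen v (projT1 x) (projT2 x).
    by have [_ _ /top_gen [L [z zg]]] := MP k; exists (existT _ L z).
  pose x k := constructive_indefinite_description _ (gen k).
  pose len k := projT1 (sval (x k)).
  have glen k : uniserial_gen v (len k) (projT2 (sval (x k))) by exact: svalP (x k).
  have injL : injective len.
    move=> i j e; apply: NNPP => /noniso; apply.
    by have := glen i; rewrite e => gi; exact: uniserial_gen_iso gi (glen j).
  move=> l; have [k lk] := inj_unbounded injL l.
  by apply: (closed_le clP) lk _; have [TM _ _] := MP k; exact: torsion_gen TM (glen k).
have [U [co Uco]] := uniserial_choice (fun=> v) S.
exists U; split=> [k|k l kl iso].
  split; first by apply: (uniserial_torsion (Uco k)); exact: uv.
    exact: (uniserial_indecomposable (Uco k)).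
  exact: (uniserial_top (Uco k)).
apply: kl; apply/eqP; rewrite eqn_leq; apply/andP; split; rewrite -ltnS.
  exact: uniserial_iso_length (Uco l) (Uco k) (iso_sym iso).
exact: uniserial_iso_length (Uco k) (Uco l) iso.
Qed.

(** With a full ray at w, a torsion-free module with simple socle has length below n, since
    otherwise some nonzero x^j z lies at w; the socle and the length determine the module. Without
    full rays P is the finite datum of some r with a zero w, and P(w-d,d) fails for d > 0. *)
Lemma Rset_torsionfree_of :
  (exists v, Rset (@torsionfree_of n K P) v) <-> ~ exists v, unbounded P v.
Proof.
split=> [[v [M [MP noniso]]] [w uw]|bd].
  have gen k : exists x : {pL : 'I_n * nat & M k},
      uniserial_gen (projT1 x).1 (projT1 x).2 (projT2 x) /\
      iter (projT1 x).2.-1 (@ordS n) (projT1 x).1 = v.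
    have [_ _ /socle_gen [p [L [z zg]]]] := MP k.
    by exists (existT _ (p, L) z).
  pose x k := constructive_indefinite_description _ (gen k).
  pose top k := (projT1 (sval (x k))).1; pose len k := (projT1 (sval (x k))).2.
  have glen k : uniserial_gen (top k) (len k) (projT2 (sval (x k))) /\
      iter (len k).-1 (@ordS n) (top k) = v by exact: svalP (x k).
  have injL : injective len.
    move=> i j e; apply: NNPP => /noniso; apply.
    have [gi vi] := glen i; have [gj vj] := glen j.
    have et : top i = top j.
      by apply: (@iter_ordS_inj n (len i).-1); rewrite vi e vj.
    by move: gi; rewrite et e => gi; exact: uniserial_gen_iso gi gj.
  have [k nk] := inj_unbounded injL n.
  have [[L0 nL zp nz _] _] := glen k.
  have [j jn jw] := fwd_reach n_gt0 (top k) w.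
  have [FM _ _] := MP k.
  have : iter j (step (M k)) (projT2 (sval (x k))) = 0.
    apply: (FM w _ (uw (len k))); last by rewrite nL.
    by rewrite (iter_fixed_idem j w zp) jw eqxx.
  move/(iter_step_ge (l := (len k).-1)) => z0; case/eqP: nz; apply: z0.
  by move: jn nk L0; lia.
have [|r [rS [w rw]] rE] := fin_datum_surj n_gt0 clP.
  by move=> p up; apply: bd; exists p.
have nP d : (0 < d)%N -> ~ P (iter d (@ord_pred n) w) d.
  by move=> d0 /rE/(_ d); rewrite d0 leqnn bwdK rw ltn0 => /(_ isT).
(* U(p k,k+1) starts k+1 steps before w, so its socle is always at w-1. *)
pose p k := iter k.+1 (@ord_pred n) w.
have pE k : iter k (@ordS n) (p k) = ord_pred w.
  by rewrite /p iterSr bwdK.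
have [U [co Uco]] := uniserial_choice p S.
exists (ord_pred w), U; split=> [k|k l kl iso].
  split.
  - apply: (uniserial_torsionfree (Uco k) clP) => j jk.
    rewrite /p fwd_bwd; last exact: ltnW.
    by apply: nP; rewrite subn_gt0.
  - exact: (uniserial_indecomposable (Uco k)).
  - by rewrite -(pE k); exact: (uniserial_socle (Uco k)).
apply: kl; apply/eqP; rewrite eqn_leq; apply/andP; split; rewrite -ltnS.
  exact: uniserial_iso_length (Uco l) (Uco k) (iso_sym iso).
exact: uniserial_iso_length (Uco k) (Uco l) iso.
Qed.

End RaysAndCorays.

(** * Part partitions, level functions and depth functions *)

Section Partitions.
Variable n : nat.
Hypothesis n_gt0 : 0 < n.
Local Notation Q := (cyclic_quiver n).
Local Notation fwd j p := (iter j (@ordS n) p).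
Local Notation bwd j p := (iter j (@ord_pred n) p).
Variable eps : nat -> bool.
Implicit Types (p q : 'I_n) (r lam : 'I_n -> nat) (D : vtuple Q).

(** The parameter [eps] says which parts must contain sinks, so that both types are treated at
    once. *)
Definition strong_partition D : Prop := disjoint_parts D /\
  forall m, 0 < m <= tlen D ->
    (if eps m then sinks (remaining D m) else sources (remaining D m))
      \subset part D m.

Definition nb_sink_steps m := \sum_(1 <= k < m) eps k.
Local Notation sigma := nb_sink_steps.

Lemma sigma1 : sigma 1 = 0.
Proof. by rewrite /sigma big_geq. Qed.

Lemma sigmaS m : 0 < m -> sigma m.+1 = sigma m + eps m.
Proof. by move=> m0; rewrite /sigma big_nat_recr. Qed.

(* The level of a vertex is the index of its part. *)
Definition level_fun lam : Prop :=
  (forall m p, 0 < m < lam p -> m <= lam (if eps m then ordS p else ord_pred p)) /\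
  exists p, lam p = 0.

Definition levels_of_depth lam r : Prop :=
  forall p m, 0 < m -> (m <= lam p) = (m <= r (fwd (sigma m) p)).

Lemma eq_thresholds a b : (forall m, 0 < m -> (m <= a) = (m <= b)) -> a = b.
Proof.
move=> E; apply/eqP; rewrite eqn_leq.
case: a b E => [|a] [|b] E //; first by have := E b.+1 isT; rewrite leqnn.
  by have := E a.+1 isT; rewrite leqnn.
by apply/andP; split; [rewrite -(E a.+1) | rewrite (E b.+1)].
Qed.

Lemma thresholds (b : nat -> bool) N : (forall m, 0 < m -> b m.+1 -> b m) ->
  (forall m, b m -> m <= N) -> exists a, forall m, 0 < m -> (m <= a) = b m.
Proof.
move=> bS bN; have exa : exists a, ~~ b a.+1.
  by exists N; apply/negP => /bN; rewrite ltnn.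
case: (ex_minnP exa) => a na min; exists a => m m0.
have le : forall k l, 0 < k -> k <= l -> b l -> b k.
  move=> k l k0; elim: l => [|l IHl]; first by rewrite leqNgt k0.
  rewrite leq_eqVlt ltnS => /predU1P [<- //|kl] bl; apply: IHl => //.
  by apply: bS bl; exact: leq_trans k0 kl.
apply/idP/idP => [ma|bm].
  case: m m0 ma => // m _ ma; apply: contraLR ma => /min.
  by rewrite -ltnNge ltnS.
by rewrite leqNgt; apply: contra na => am; exact: le bm.
Qed.

(** The translated sets {r >= m} must be nested and satisfy the level condition. At a sink step
    nestedness is r(p+1) <= r(p) + 1 and the level condition is immediate; at a source step the two
    exchange roles. *)
Lemma level_exists r : depth_fun r ->
  exists2 lam, level_fun lam & levels_of_depth lam r.
Proof.
case=> rS [z rz].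
have ex p : exists a, forall m, 0 < m -> (m <= a) = (m <= r (fwd (sigma m) p)).
  apply: (@thresholds _ (\max_q r q)) => [m m0|m mr]; last first.
    by apply: leq_trans mr _; exact: leq_bigmax.
  rewrite sigmaS //; case: (eps m); last by rewrite addn0; exact: ltnW.
  by rewrite addn1 iterS => h; rewrite -ltnS; exact: leq_trans h (rS _).
have /fin_all_exists [lam lamE] := ex.
exists lam => //; split; last first.
  exists z; apply/eqP; rewrite -leqn0 leqNgt lamE // sigma1 /=.
  by rewrite rz.
move=> m p /andP [m0]; rewrite !lamE // sigmaS //; case: (eps m).
  by rewrite addn1 iterSr; exact: ltnW.
rewrite addn0 => h; rewrite -ltnS; apply: leq_trans h _.
by rewrite -[p in fwd _ p]ord_predK -iterSr iterS; exact: rS.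
Qed.

(** The same exchange backwards: the level condition gives nestedness at sink steps and the slope
    bound on r at source steps. *)
Lemma depth_exists lam : level_fun lam ->
  exists2 r, depth_fun r & levels_of_depth lam r.
Proof.
case=> lamS [z lz].
have ex q : exists a, forall m, 0 < m -> (m <= a) = (m <= lam (bwd (sigma m) q)).
  apply: (@thresholds _ (\max_q lam q)) => [m m0|m mr]; last first.
    by apply: leq_trans mr _; exact: leq_bigmax.
  rewrite sigmaS // => h; have := lamS m _ (introT andP (conj m0 h)).
  case: (eps m) h; last by rewrite addn0 => /ltnW.
  by rewrite addn1 iterS ord_predK.
have /fin_all_exists [r rE] := ex.
exists r; last by move=> p m m0; rewrite rE // fwdK.
split; last first.
  exists z; apply/eqP; rewrite -leqn0 leqNgt rE // sigma1 /=.
  by rewrite lz.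
move=> q; case E: (r (ordS q)) => [//|[//|m]]; rewrite ltnS.
have : m.+1 < r (ordS q) by rewrite E.
rewrite !rE // sigmaS // => h; have := lamS m.+1 _ (introT andP (conj (ltn0Sn m) h)).
case: (eps m.+1) h; last by rewrite addn0 -iterS iterSr ordSK.
by rewrite addn1 iterSr ordSK => /ltnW.
Qed.

Definition parts_of lam : vtuple Q :=
  ([set p : 'I_n | lam p == 0],
   mkseq (fun i => [set p : 'I_n | lam p == i.+1]) (\max_p lam p)).

Lemma part_parts_of lam i : part (parts_of lam) i = [set p : 'I_n | lam p == i].
Proof.
case: i => // i; rewrite /part /=.
case: (ltnP i (\max_p lam p)) => h; first by rewrite nth_mkseq.
rewrite nth_default ?size_mkseq //; apply/setP => p; rewrite !inE.
by apply/esym/negbTE; rewrite neq_ltn ltnS (leq_trans _ h) // leq_bigmax.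
Qed.

Lemma remaining_parts_of lam m :
  remaining (parts_of lam) m = [set p : 'I_n | m <= lam p].
Proof.
apply/setP => p; rewrite !inE leqNgt; congr (~~ _); apply/bigcupP/idP.
  by case=> -[i im] _; rewrite part_parts_of inE => /eqP ->.
by move=> pm; exists (Ordinal pm) => //; rewrite part_parts_of inE.
Qed.

Lemma sinksP (O : {set 'I_n}) p :
  reflect (p \in O /\ ordS p \notin O) (p \in @sinks Q O).
Proof.
rewrite inE; apply: (iffP andP) => -[pO H]; split=> //.
  by have /forallP /(_ p) := H; rewrite eqxx.
by apply/forallP => a; apply/nandP; case: (eqVneq (a : 'I_n) p) => [->|]; [right|left].
Qed.

Lemma sourcesP (O : {set 'I_n}) p :
  reflect (p \in O /\ ord_pred p \notin O) (p \in @sources Q O).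
Proof.
rewrite inE; apply: (iffP andP) => -[pO H]; split=> //.
  by have /forallP /(_ (ord_pred p)) := H; rewrite /= ord_predK eqxx.
apply/forallP => a; apply/nandP; case: (eqVneq (ordS a) p) => [ap|]; last by left.
by right; rewrite -ap ordSK in H.
Qed.

Lemma boundaryP (O : {set 'I_n}) m p :
  reflect (p \in O /\ (if eps m then ordS p else ord_pred p) \notin O)
    (p \in (if eps m then @sinks Q O else @sources Q O)).
Proof. by case: (eps m); [exact: sinksP | exact: sourcesP]. Qed.

(** Walking from p in the direction selected by [eps], the last vertex before first leaving O is a
    sink or source of it. *)
Lemma boundary_exists (O : {set 'I_n}) m p z : p \in O -> z \notin O ->
  exists q : 'I_n, q \in (if eps m then @sinks Q O else @sources Q O).
Proof.
move=> pO zO; have exj : exists j, iter j (if eps m then @ordS n else @ord_pred n) p \notin O.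
  case: (eps m); first by have [j _ jz] := fwd_reach n_gt0 p z; exists j; rewrite jz.
  by have [j _ jz] := bwd_reach_pos n_gt0 p z; exists j; rewrite jz.
case: (ex_minnP exj) => -[|j] jO min; first by rewrite pO in jO.
exists (iter j (if eps m then @ordS n else @ord_pred n) p); apply/boundaryP; split.
  by apply: contraT => /min; rewrite ltnn.
by move: jO => /=; case: (eps m).
Qed.

(** A sink or source of {lam >= m} has level exactly m, because at a higher level the level
    condition keeps its neighbour in the set. As the set misses a zero of lam, it has such a vertex
    when nonempty, so no part is empty. *)
Lemma level_strong_partition lam : level_fun lam ->
  [/\ strong_partition (parts_of lam), complete_parts (parts_of lam)
    & part (parts_of lam) 0 <> set0].
Proof.
case=> lamS [z lz]; have tl : tlen (parts_of lam) = \max_p lam p by exact: size_mkseq.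
have sub m : 0 < m ->
    (if eps m then @sinks Q [set p | m <= lam p] else @sources Q [set p | m <= lam p])
      \subset [set p | lam p == m].
  move=> m0; apply/subsetP => p /boundaryP []; rewrite !inE => mp nmp.
  rewrite eqn_leq mp andbT leqNgt; apply: contra nmp => h.
  by have := lamS m p; rewrite m0 h => /(_ isT).
split.
- split; first split.
  + move=> i j /andP [ij _]; rewrite !part_parts_of -setI_eq0; apply/eqP/setP => p.
    by rewrite !inE; apply/negbTE/negP => /andP [/eqP -> /eqP e]; rewrite e ltnn in ij.
  + move=> i; rewrite tl part_parts_of => /andP [i0 imax].
    have /existsP [p pi] : [exists p, i <= lam p].
      apply: contraLR imax => /existsPn H; rewrite -ltnNge -(prednK i0) ltnS.
      by apply/bigmax_leqP => p _; rewrite -ltnS prednK // ltnNge.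
    have [||q qb] := @boundary_exists [set p | i <= lam p] i p z; rewrite ?inE //.
      by rewrite lz -ltnNge.
    by apply/set0Pn; exists q; exact: (subsetP (sub i i0)).
  + by move=> m /andP [m0 _]; rewrite remaining_parts_of part_parts_of; exact: sub.
- apply/setP => p; rewrite [RHS]inE; apply/bigcupP.
  have lt : lam p < (tlen (parts_of lam)).+1 by rewrite tl ltnS leq_bigmax.
  by exists (Ordinal lt) => //; rewrite part_parts_of inE.
- by rewrite part_parts_of => /setP /(_ z); rewrite !inE lz eqxx.
Qed.

(** Here lam(p) is the index of the unique part containing p. If the level condition failed at m <
    lam(p), p would be a sink or source of the remaining set and lie in part m. *)
Lemma parts_of_surj D : strong_partition D -> complete_parts D ->
  part D 0 <> set0 -> exists2 lam, level_fun lam & D = parts_of lam.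
Proof.
move=> [[disj nonempty] strong] compl part0.
have ex (p : 'I_n) : exists i, (i <= tlen D) && (p \in part D i).
  have : p \in [set: vertex Q] by rewrite inE.
  by rewrite -compl => /bigcupP [[i ilt] _ pi]; exists i; rewrite pi andbT.
have /fin_all_exists [lam lamP] := ex.
have lamE (p : 'I_n) i : i <= tlen D -> (p \in part D i) = (lam p == i).
  have /andP [lt pl] := lamP p => it; apply/idP/eqP => [pi|<- //].
  have nd j k : j < k -> k <= tlen D -> p \in part D j -> p \in part D k -> False.
    move=> jk kt pj pk; have jkt : j < k <= tlen D by rewrite jk.
    by have := disjointFr (disj j k jkt) pj; rewrite pk.
  by case: (ltngtP (lam p) i) => // h; case: (nd _ _ h).
have lam_le p : lam p <= tlen D by have /andP [] := lamP p.
have tlE : tlen D = \max_p lam p.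
  apply/eqP; rewrite eqn_leq; apply/andP; split; last first.
    by apply/bigmax_leqP => p _.
  case: (posnP (tlen D)) => [-> //|t0].
  have tt : 0 < tlen D <= tlen D by rewrite t0 leqnn.
  have /set0Pn [p] := nonempty _ tt.
  by rewrite lamE // => /eqP <-; exact: leq_bigmax.
have DE : D = parts_of lam.
  have partE i : i <= tlen D -> part D i = [set p : 'I_n | lam p == i].
    by move=> it; apply/setP => p; rewrite lamE // inE.
  rewrite [D]surjective_pairing; congr pair; first exact: (partE 0).
  apply: (@eq_from_nth _ set0) => [|i it]; rewrite ?size_mkseq //.
  by rewrite nth_mkseq -?tlE //; exact: (partE i.+1).
exists lam => //; split=> [m p /andP [m0 mp]|]; last first.
  have /set0Pn [p] : part D 0 != set0 by apply/eqP.
  by rewrite lamE // => /eqP; exists p.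
rewrite leqNgt; apply/negP => lt.
have mt : 0 < m <= tlen D by rewrite m0 (leq_trans (ltnW mp)).
have /subsetP /(_ p) := strong m mt.
rewrite DE remaining_parts_of part_parts_of inE => H.
have : lam p == m by apply: H; apply/boundaryP; rewrite !inE -ltnNge lt (ltnW mp).
by move/eqP => e; rewrite e ltnn in mp.
Qed.

Lemma parts_of_inj lam lam' : parts_of lam = parts_of lam' -> lam =1 lam'.
Proof.
move=> E p; apply/eqP; have := part_parts_of lam (lam' p).
by rewrite E part_parts_of => /setP /(_ p); rewrite !inE eqxx => <-.
Qed.

Lemma depth_levels_inj lam r r' :
  levels_of_depth lam r -> levels_of_depth lam r' -> r =1 r'.
Proof.
move=> H H' p; apply: eq_thresholds => m m0.
by have := H (bwd (sigma m) p) m m0; rewrite H' // !bwdK.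
Qed.

End Partitions.

Lemma odd_even_steps (A B : nat -> Prop) N :
  (forall i, 0 < i -> (2 * i - 1 <= N -> A (2 * i - 1)) /\ (2 * i <= N -> B (2 * i)))
  <-> forall m, 0 < m <= N -> if odd m then A m else B m.
Proof.
split=> [H m /andP [m0 mN]|H i i0].
  case: (boolP (odd m)) => om.
    have e : m = 2 * uphalf m - 1 by lia.
    by rewrite e; apply: (proj1 (H (uphalf m) _)); lia.
  have e : m = 2 * uphalf m by lia.
  by rewrite e; apply: (proj2 (H (uphalf m) _)); lia.
have odd1 : odd (2 * i - 1) by lia.
have odd2 : odd (2 * i) = false by lia.
split=> iN.
  by have := H (2 * i - 1); rewrite odd1; apply; lia.
by have := H (2 * i); rewrite odd2; apply; lia.
Qed.

Section StrongPartitions.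
Variable n : nat.
Local Notation Q := (cyclic_quiver n).

Lemma strong1E (D : vtuple Q) :
  strong1_part_partition D <-> strong_partition odd D.
Proof.
have E := odd_even_steps (fun m => is_true (sinks (remaining D m) \subset part D m))
  (fun m => is_true (sources (remaining D m) \subset part D m)) (tlen D).
split=> -[dD H]; split=> //.
  by move/E: H => H m /H; case: (odd m).
by apply/E => m /H; case: (odd m).
Qed.

Lemma strong2E (D : vtuple Q) :
  strong2_part_partition D <-> strong_partition (fun m => ~~ odd m) D.
Proof.
have E := odd_even_steps (fun m => is_true (sources (remaining D m) \subset part D m))
  (fun m => is_true (sinks (remaining D m) \subset part D m)) (tlen D).
split=> -[dD H]; split=> //.
  by move/E: H => H m /H; case: (odd m).
by apply/E => m /H; case: (odd m).
Qed.

End StrongPartitions.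

(** * Both sides parametrised by depth functions *)

Section Bijections.
Variables (n : nat) (K : fieldType).
Hypothesis n_gt0 : 0 < n.
Local Notation Q := (cyclic_quiver n).

Definition param_by (A X : Type) (PA : A -> Prop) (PX : X -> Prop) (g : A -> X) :=
  [/\ forall a, PA a -> PX (g a),
      forall a b, PA a -> PA b -> g a = g b -> a = b
    & forall x, PX x -> exists2 a, PA a & g a = x].

Lemma param_bijection (A X Y : Type) PA PX PY (g : A -> X) (h : A -> Y) :
  param_by PA PX g -> param_by PA PY h ->
  exists f : {x | PX x} -> {y | PY y}, bijective f.
Proof.
case=> gP gI gS [hP hI hS].
have gS' (x : {x | PX x}) : exists a, PA a /\ g a = sval x.
  by have [a Pa ga] := gS _ (svalP x); exists a.
have hS' (y : {y | PY y}) : exists a, PA a /\ h a = sval y.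
  by have [a Pa ha] := hS _ (svalP y); exists a.
pose gi x := constructive_indefinite_description _ (gS' x).
pose hi y := constructive_indefinite_description _ (hS' y).
have giP x : PA (sval (gi x)) /\ g (sval (gi x)) = sval x by exact: svalP (gi x).
have hiP y : PA (sval (hi y)) /\ h (sval (hi y)) = sval y by exact: svalP (hi y).
pose f x : {y | PY y} := exist _ _ (hP _ (proj1 (giP x))).
pose f' y : {x | PX x} := exist _ _ (gP _ (proj1 (hiP y))).
have sig_eq (T : Type) (P : T -> Prop) (u v : {t | P t}) : sval u = sval v -> u = v.
  by case: u v => [u Pu] [v Pv] /= e; subst v; rewrite (proof_irrelevance _ Pu Pv).
exists f, f' => [x|y]; apply: sig_eq => /=.
  have [Pa ga] := giP x; have [Pb hb] := hiP (f x).
  by rewrite (hI _ _ Pb Pa hb).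
have [Pa ga] := giP (f' y); have [Pb hb] := hiP y.
by rewrite (gI _ _ Pa Pb ga).
Qed.

Definition pair_of (P : 'I_n -> nat -> Prop) :=
  (@torsion_of n K P, @torsionfree_of n K P).

Lemma data_ext (P P' : 'I_n -> nat -> Prop) :
  (forall p l, P p l <-> P' p l) -> P = P'.
Proof.
move=> E; apply: functional_extensionality => p.
by apply: functional_extensionality => l; apply: propositional_extensionality.
Qed.

Lemma pair_of_inj P P' : extension_closed P -> extension_closed P' ->
  pair_of P = pair_of P' -> P = P'.
Proof.
move=> cl cl' [_ E]; apply: data_ext => p l.
by rewrite -(datum_torsionfree_of K cl) E (datum_torsionfree_of K cl').
Qed.

Lemma pair_of_surj TF : torsion_pair TF ->
  exists2 P, extension_closed P & TF = pair_of P.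
Proof.
case: TF => T F TF; exists (datum F); first exact: datum_closed.
by have [ET EF] := torsion_pairE TF; rewrite /pair_of -ET -EF.
Qed.

(** L_T is the set of tops of full rays, so the pairs considered are those whose datum is covered by
    [inf_datum_surj]. *)
Lemma inf_datum_param :
  param_by (@depth_fun n)
    (fun TF => torsion_pair TF /\ exists v, Lset TF.1 v)
    (fun r => pair_of (inf_datum r)).
Proof.
have cl r := @inf_datum_closed n r; split=> [r rP|r r' rP rP' E|TF [tTF [v Lv]]].
- split; first exact: torsion_pair_of.
  have [_ [p rp]] := rP; exists p.
  by apply/Lset_torsion_of => //; apply/(inf_datum_unbounded n_gt0).
- apply: functional_extensionality; apply: (inf_datum_inj n_gt0 rP rP') => p l.
  by rewrite (pair_of_inj (cl r) (cl r') E).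
- have [P clP E] := pair_of_surj tTF.
  have uP : exists p, unbounded P p.
    by exists v; apply/(Lset_torsion_of K clP); rewrite E in Lv.
  have [r rP rE] := inf_datum_surj n_gt0 clP uP.
  by exists r; rewrite // E; congr pair_of; apply: data_ext => p l; rewrite rE.
Qed.

Lemma fin_datum_param :
  param_by (@depth_fun n)
    (fun TF => torsion_pair TF /\ exists v, Rset TF.2 v)
    (fun r => pair_of (fin_datum r)).
Proof.
have cl r := @fin_datum_closed n r; split=> [r rP|r r' rP rP' E|TF [tTF [v Rv]]].
- split; first exact: torsion_pair_of.
  apply/Rset_torsionfree_of => // -[p /(_ n)]; exact: fin_datum_bounded.
- apply: functional_extensionality; apply: (fin_datum_inj n_gt0 rP rP') => p l.
  by rewrite (pair_of_inj (cl r) (cl r') E).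
- have [P clP E] := pair_of_surj tTF.
  have bP : ~ exists p, unbounded P p.
    by apply/(Rset_torsionfree_of K n_gt0 clP); exists v; rewrite E in Rv.
  have [|r rP rE] := fin_datum_surj n_gt0 clP; first by move=> p up; apply: bP; exists p.
  by exists r; rewrite // E; congr pair_of; apply: data_ext => p l; rewrite rE.
Qed.

Lemma partition_param (eps : nat -> bool) (PD : vtuple Q -> Prop) :
  (forall D, PD D <-> strong_partition eps D) ->
  exists h, param_by (@depth_fun n)
    (fun D => PD D /\ complete_parts D /\ part D 0 <> set0) h.
Proof.
move=> PDE.
have exh (r : 'I_n -> nat) : exists D, depth_fun r ->
    exists lam, [/\ level_fun eps lam, levels_of_depth eps lam r & D = parts_of lam].
  (* A default value outside the depth functions makes the choice total. *)
  case: (classic (depth_fun r)) => [rP|nr]; last by exists (set0, [::]).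
  by have [lam lP lr] := level_exists eps rP; exists (parts_of lam); exists lam.
pose h r := sval (constructive_indefinite_description _ (exh r)).
have hP r : depth_fun r -> exists lam,
    [/\ level_fun eps lam, levels_of_depth eps lam r & h r = parts_of lam].
  exact: svalP (constructive_indefinite_description _ (exh r)).
exists h; split=> [r /hP [lam [lP _ ->]]|r r' /hP [lam [_ lr ->]] /hP [lam' [_ lr' ->]]|].
- have [sp cp p0] := level_strong_partition n_gt0 lP.
  by split; [exact/PDE | split].
- move/parts_of_inj => E; apply: functional_extensionality.
  apply: (depth_levels_inj (lam := lam) lr) => p m m0.
  by rewrite E; exact: lr'.
- move=> D [/PDE sp [cp p0]]; have [lam lP ->] := parts_of_surj sp cp p0.
  have [r rP lr] := depth_exists lP; exists r => //.
  have [lam' [_ lr' ->]] := hP r rP; congr parts_of.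
  apply: functional_extensionality => p; apply: eq_thresholds => m m0.
  by rewrite lr // lr'.
Qed.

End Bijections.

Theorem theorem4p15 (K : fieldType) (n : nat) (hn : 0 < n) :
  (exists f :
     {TF : (nilmod (cyclic_quiver n) K -> Prop)
           * (nilmod (cyclic_quiver n) K -> Prop)
        | torsion_pair TF /\ exists v, Lset TF.1 v} ->
     {D : vtuple (cyclic_quiver n)
        | strong1_part_partition D /\ complete_parts D /\ part D 0 <> set0},
     bijective f)
  /\
  (exists f :
     {TF : (nilmod (cyclic_quiver n) K -> Prop)
           * (nilmod (cyclic_quiver n) K -> Prop)
        | torsion_pair TF /\ exists v, Rset TF.2 v} ->
     {D : vtuple (cyclic_quiver n)
        | strong2_part_partition D /\ complete_parts D /\ part D 0 <> set0},
     bijective f).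
Proof.
split.
  have [h hP] := partition_param hn (@strong1E n).
  exact: param_bijection (inf_datum_param K hn) hP.
have [h hP] := partition_param hn (@strong2E n).
exact: param_bijection (fin_datum_param K hn) hP.
Qed.
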